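(* Let $n,d\ge 1$ be integers, let $\Delta=\{(t,s)\in\mathbb{R}^2: 0\le s\le t<+\infty\}$, and let $B=(B_1,\dots,B_d)$ be a $d$-dimensional vector of mutually independent standard Brownian motions. Let $H:\Delta\to\mathbb{R}^{n\times n}$ be continuous with $H\in C^{1,0}(\Delta;\mathbb{R}^{n\times n})$, and write $H_1(t,s)=\frac{\partial H}{\partial t}(t,s)$ for the partial derivative of $H$ with respect to its first argument. Suppose that there exists $H_\infty\in C([0,\infty);\mathbb{R}^{n\times n})$ such that $\int_0^\infty\|H_\infty(s)\|^2\,ds<+\infty$ and $$\lim_{t\to\infty}\left(\int_0^t\|H(t,s)-H_\infty(s)\|^2\,ds\right)\cdot\log t=0,$$ and that there exist $q\ge 0$ and $c_q>0$ such that, for all $t\ge 0$, $$\int_0^t\|H_1(t,s)\|^2\,ds\le c_q(1+t)^{2q}\quad\text{and}\quad \|H(t,t)\|^2\le c_q(1+t)^{2q}.$$ Then for each $f\in BC([0,\infty);\mathbb{R}^{n\times d})$, $$\lim_{t\to\infty}\int_0^t H(t,s)f(s)\,dB(s)=\int_0^\infty H_\infty(s)f(s)\,dB(s)\quad\text{almost surely}.$$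
   Context: $C([0,\infty);\mathbb{R}^{n\times n})$ is the space of continuous $\mathbb{R}^{n\times n}$-valued functions on $[0,\infty)$, and $BC([0,\infty);\mathbb{R}^{n\times d})$ is the space of bounded continuous $\mathbb{R}^{n\times d}$-valued functions on $[0,\infty)$. $C^{1,0}(\Delta;\mathbb{R}^{n\times n})$ is the space of functions on $\Delta$ that are continuously differentiable in their first argument and continuous in their second argument; that is, $H$ is continuous and $H_1=\partial H/\partial t$ exists and is continuous on $\Delta$ (one-sided derivative at points $t=s$). $\|\cdot\|$ denotes the Euclidean norm on vectors and the Frobenius norm on matrices. $H$ and $f$ are deterministic; for each fixed $t$, $\int_0^t H(t,s)f(s)\,dB(s)$ is the $\mathbb{R}^n$-valued It\^o integral (with respect to the natural filtration of $B$) of the deterministic integrand $s\mapsto H(t,s)f(s)$. Under the hypotheses the process $t\mapsto\int_0^t H(t,s)f(s)\,dB(s)$ has a version with continuous sample paths, and it is this version that is meant in the conclusion. A process $X$ converges almost surely to $X_\infty$ if there is a $\mathbb{P}$-null set $\Omega_0$ such that $\lim_{t\to\infty}X(t,\omega)=X_\infty(\omega)$ for all $\omega\notin\Omega_0$. *)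

(* Defs.v *)
From HB Require Import structures.
From mathcomp Require Export all_boot all_order all_algebra.
From mathcomp Require Export all_classical all_reals all_analysis.
Export Order.TTheory GRing.Theory Num.Theory.
Export numFieldNormedType.Exports.

Set Implicit Arguments.
Unset Strict Implicit.
Unset Printing Implicit Defensive.

Local Open Scope classical_set_scope.
Local Open Scope ring_scope.

Section Deterministic.
Context {R : realType}.

(* The library norm on matrices is the max norm; this is the Frobenius norm,
   i.e. the Euclidean norm on column vectors. *)
Definition fnorm (m n : nat) (A : 'M[R]_(m, n)) : R :=
  Num.sqrt (\sum_(i < m) \sum_(j < n) A i j ^+ 2).

Definition Delta : set (R * R) := [set p | 0 <= p.2 <= p.1].

(* H is in C^{1,0}(Delta) with partial derivative H1 in the first argument.
   Kernels are total functions whose values off Delta are irrelevant.  The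
   difference quotient at (t, s) uses only points u >= s, hence is two-sided
   when t > s and one-sided when t = s. *)
Definition C10 (m n : nat) (H H1 : R -> R -> 'M[R]_(m, n)) : Prop :=
  [/\ {within Delta, continuous (fun p : R * R => H p.1 p.2)},
      {within Delta, continuous (fun p : R * R => H1 p.1 p.2)}
    & forall t s : R, Delta (t, s) ->
        (u - t)^-1 *: (H u s - H t s) @[u --> within [set u | s <= u] t^']
          --> H1 t s].

End Deterministic.

Section Brownian.
Context {R : realType} {disp : measure_display} {T : measurableType disp}.
Variable P : probability T R.

Definition mutually_independent_RVs (k : nat) (X : 'I_k -> T -> R) : Prop :=
  forall A : 'I_k -> set R, (forall i, measurable (A i)) ->
    (P (\bigcap_(i in [set: 'I_k]) (X i @^-1` A i)) =
     \prod_(i < k) P (X i @^-1` A i))%E.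

(* Processes are indexed by all of R, but only times t >= 0 matter. *)
Definition standard_BM (W : R -> T -> R) : Prop :=
  [/\ forall t, 0 <= t -> measurable_fun setT (W t),
      {ae P, forall w, W 0 w = 0},
      forall s t, 0 <= s -> s < t -> forall A : set R, measurable A ->
        P ((fun w => W t w - W s w) @^-1` A) =
        normal_prob 0 (Num.sqrt (t - s)) A,
      forall (k : nat) (t : nat -> R), 0 <= t 0%N ->
        (forall i, t i <= t i.+1) ->
        mutually_independent_RVs
          (fun (i : 'I_k) w => W (t i.+1) w - W (t i) w)
    & {ae P, forall w, {within `[0, +oo[, continuous (W ^~ w)}}].

Definition sigma_of_process (W : R -> T -> R) : set (set T) :=
  <<s [set E | exists t : R, exists A : set R,
         [/\ 0 <= t, measurable A & E = W t @^-1` A]] >>.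

Definition mutually_independent_BMs (d : nat) (B : 'I_d -> R -> T -> R) : Prop :=
  (forall j, standard_BM (B j)) /\
  (forall E : 'I_d -> set T, (forall j, sigma_of_process (B j) (E j)) ->
    (P (\bigcap_(j in [set: 'I_d]) E j) = \prod_(j < d) P (E j))%E).

Definition natural_filtration (d : nat) (B : 'I_d -> R -> T -> R) (t : R) :
    set (set T) :=
  <<s [set E | exists j : 'I_d, exists u : R, exists A : set R,
         [/\ 0 <= u <= t, measurable A & E = B j u @^-1` A]] >>.

End Brownian.

Section Ito.
Context {R : realType} {disp : measure_display} {T : measurableType disp}.
Variables (P : probability T R) (n d : nat) (B : 'I_d -> R -> T -> R).

(* The step process  sum_{k < sp_size} sp_coef k * 1_{(sp_time k, sp_time k.+1]}. *)
Record simple_process := SimpleProcess {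
  sp_size : nat;
  sp_time : nat -> R;
  sp_coef : nat -> T -> 'M[R]_(n, d) }.

Definition sp_val (S : simple_process) (s : R) (w : T) : 'M[R]_(n, d) :=
  \sum_(k < sp_size S | sp_time S k < s <= sp_time S k.+1) sp_coef S k w.

Definition BM_vec (t : R) (w : T) : 'cV[R]_d := \col_j B j t w.

Definition sp_int (S : simple_process) (w : T) : 'cV[R]_n :=
  \sum_(k < sp_size S)
    sp_coef S k w *m (BM_vec (sp_time S k.+1) w - BM_vec (sp_time S k) w).

Definition admissible (D : set R) (S : simple_process) : Prop :=
  [/\ forall k, (k < sp_size S)%N -> sp_time S k <= sp_time S k.+1,
      forall k, (k <= sp_size S)%N -> D (sp_time S k),
      forall k, (k < sp_size S)%N -> forall i j (A : set R), measurable A ->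
        natural_filtration B (sp_time S k)
          ((fun w => sp_coef S k w i j) @^-1` A)
    & exists M : R, forall k, (k < sp_size S)%N ->
        forall w, fnorm (sp_coef S k w) <= M].

Definition approximates (D : set R) (g : R -> 'M[R]_(n, d))
    (S : nat -> simple_process) : Prop :=
  (forall k, admissible D (S k)) /\
  (\int[P]_w \int[lebesgue_measure]_(s in D)
     (fnorm (sp_val (S k) s w - g s) ^+ 2)%:E)%E @[k --> \oo] --> 0%E.

(* X is (a version of) the Ito integral over the time interval D, a subset of
   [0, +oo[, of the deterministic integrand g with respect to B: g lies in the
   L^2(P x ds)-closure of the simple adapted processes, and X is the
   L^2(P)-limit of the integrals of simple processes tending to g.  By Ito's
   isometry, one approximating sequence suffices to determine X almost surely. *)
Definition is_ito_integral (D : set R) (g : R -> 'M[R]_(n, d))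
    (X : T -> 'cV[R]_n) : Prop :=
  [/\ forall i, measurable_fun setT (fun w => X w i 0),
      exists S, approximates D g S
    & forall S, approximates D g S ->
        (\int[P]_w (fnorm (sp_int (S k) w - X w) ^+ 2)%:E)%E @[k --> \oo]
          --> 0%E].

End Ito.

(* Main.v *)
Require Import Defs.
From mathcomp Require Import measurable_realfun ring lra.
Import HBNNSimple.

(** Since [f], [H] and [Hinf] are deterministic, [X t - Xinf] is a limit in mean
    square of linear combinations of Brownian increments.  It is therefore
    Gaussian, with tail [exp (- a ^ 2 / (48 v))] as soon as the squared
    distance [v] in L2 of the two integrands is known: this is [wiener_tail], and
    [wiener_ito] makes it available for the integrals of the theorem.  All almost
    sure bounds below come from this tail and from the Borel-Cantelli lemma in the
    form [ae_eventually_le].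

    Let [M t] be the integral of [Hinf s *m f s] over the segment from 0 to [t].
    The variance of [X t - M t] is [o(1 / log t)].  This is exactly what is
    needed to make [X t - M t] tend to 0 along a set of times that is
    polynomially dense: for [t] between [2 ^ l] and [2 ^ l.+1] the grid of mesh
    [A ^- l] has at most [2 * (2 * A) ^ l] points, at each of which
    a given deviation has probability at most [exp (- K l)] for large [l],
    whatever [K] ([ae_grid_values]).

    Between the grid points, the bounds on [H1] and on the diagonal of [H] give
    mean square increments of [X] of order [(1 + t) ^ p * (t - s)]
    ([kernel_increment_L2], [integrand_increment]).  If the base [A] is large
    compared with [2 ^ p], refining the grid from scale [l] on costs at most
    a geometric series ([ae_grid_increments]), and continuity of the paths
    brings every time within reach.

    It remains that [M t] tends to [Xinf].  The variance of [Xinf - M t] may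
    decay more slowly than [1 / log t], so that a union bound over times
    fails.  But [M] is a time-changed Brownian motion whose clock, the integral of
    the squared norm of [Hinf s *m f s], is bounded: cutting the range of the clock
    rather than time into cells of length [16 ^- l] leaves a multiple of
    [16 ^ l] variables at scale [l], among which chaining works
    ([ae_clock_increments], [ae_clock_end]).  The process [M] is not constructed; in
    each cell it is represented by the integral of a truncated step function
    ([clock_array]).

    The deterministic lemma [chaining_cvg] assembles the four bounds. *)

Set Implicit Arguments.
Unset Strict Implicit.
Unset Printing Implicit Defensive.
Local Open Scope classical_set_scope.
Local Open Scope ring_scope.

(** * Simple functions, weights and independence *)

Section weighted_laws.
Context (R : realType).

Lemma integral_weighted_nnsfun (disp : measure_display)
    (T : measurableType disp) (P : {measure set T -> \bar R})
    (W : T -> R) (Y : T -> R) (g : {nnsfun R >-> R}) :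
  (forall w, 0 <= W w) -> measurable_fun setT W -> measurable_fun setT Y ->
  (\int[P]_w (W w * g (Y w))%:E =
   \sum_(y \in range g) y%:E * \int[P]_w (W w * \1_(g @^-1` [set y]) (Y w))%:E)%E.
Proof.
move=> W0 mW mY.
have mi y : measurable_fun setT (fun w => \1_(g @^-1` [set y]) (Y w) : R).
  apply: (measurableT_comp _ mY); apply: measurable_indic; exact: measurable_sfunP.
have r0 y : ~ 0 <= y -> g @^-1` [set y] = set0.
  move=> y0; rewrite -subset0 => x /= gx; apply: y0; rewrite -gx.
  exact: fun_ge0.
transitivity (\int[P]_w \sum_(y \in range g)
    ((y * (W w * \1_(g @^-1` [set y]) (Y w)))%:E))%E.
  apply: eq_integral => w _.
  rewrite fimfunE fsumEFin//; congr EFin.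
  by rewrite mulr_fsumr//; apply: eq_fsbigr => y _; ring.
rewrite ge0_integral_fsum//.
- apply: eq_fsbigr => y _.
  have [y0|/negP y0] := boolP (0 <= y).
    under eq_integral do rewrite EFinM.
    rewrite ge0_integralZl_EFin//.
    + by move=> w _; rewrite lee_fin mulr_ge0.
    + exact/measurable_EFinP/measurable_funM.
  under eq_integral do rewrite r0// indic0 !mulr0.
  under [in RHS]eq_integral do rewrite r0// indic0 !mulr0.
  by rewrite integral0 mule0.
- move=> y; apply/measurable_EFinP/measurable_funM => //.
  exact: measurable_funM.
- move=> y w _; rewrite lee_fin.
  have [y0|/negP y0] := boolP (0 <= y); first by rewrite !mulr_ge0.
  by rewrite r0// indic0 !mulr0.
Qed.

(** Lifts an identity from indicators to all nonnegative measurable functions,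
    through simple functions and monotone convergence.  The weights allow the
    same lemma to be used for a law given by a density and for a product of
    independent factors, all factors but one being put into the weight. *)
Lemma eq_integral_weighted (d1 d2 : measure_display)
    (T1 : measurableType d1) (P1 : {measure set T1 -> \bar R})
    (T2 : measurableType d2) (P2 : {measure set T2 -> \bar R})
    (W1 Y1 : T1 -> R) (W2 Y2 : T2 -> R) :
  (forall w, 0 <= W1 w) -> measurable_fun setT W1 -> measurable_fun setT Y1 ->
  (forall w, 0 <= W2 w) -> measurable_fun setT W2 -> measurable_fun setT Y2 ->
  (forall A : set R, measurable A ->
     (\int[P1]_w (W1 w * \1_A (Y1 w))%:E = \int[P2]_w (W2 w * \1_A (Y2 w))%:E)%E) ->
  forall h : R -> R, (forall x, 0 <= h x) -> measurable_fun setT h ->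
    (\int[P1]_w (W1 w * h (Y1 w))%:E = \int[P2]_w (W2 w * h (Y2 w))%:E)%E.
Proof.
move=> W10 mW1 mY1 W20 mW2 mY2 W12 h h0 mh.
have /measurable_EFinP mEh := mh.
pose g := nnsfun_approx measurableT mEh.
have mg n : measurable_fun setT (g n) by [].
have nd_g x : nondecreasing_seq (g ^~ x).
  by move=> m n mn; exact/lefP/nd_nnsfun_approx.
have cvg_g x : (g n x)%:E @[n --> \oo] --> (h x)%:E.
  by apply: (@cvg_nnsfun_approx _ _ _ _ measurableT _ mEh) => // y _;
    rewrite lee_fin.
have key d (T : measurableType d) (P : {measure set T -> \bar R}) (W Y : T -> R) :
    (forall w, 0 <= W w) -> measurable_fun setT W -> measurable_fun setT Y ->
    (\int[P]_w (W w * g n (Y w))%:E)%E @[n --> \oo] -->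
    (\int[P]_w (W w * h (Y w))%:E)%E.
  move=> W0 mW mY.
  have mgY n : measurable_fun setT (fun w => g n (Y w)) by exact: measurableT_comp.
  have -> : (\int[P]_w (W w * h (Y w))%:E =
     \int[P]_w limn (fun n => (W w * g n (Y w))%:E))%E.
    apply: eq_integral => w _; apply/esym/cvg_lim => //.
    under eq_fun do rewrite EFinM; rewrite EFinM.
    exact: cvgeZl.
  apply: cvg_monotone_convergence => //.
  - by move=> n; apply/measurable_EFinP/measurable_funM.
  - by move=> n w _; rewrite lee_fin mulr_ge0 ?fun_ge0.
  - by move=> w _ m n mn; rewrite lee_fin ler_wpM2l//; exact: nd_g.
have := key _ _ P1 _ _ W10 mW1 mY1.
have -> : (fun n => (\int[P1]_w (W1 w * g n (Y1 w))%:E)%E) =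
          (fun n => (\int[P2]_w (W2 w * g n (Y2 w))%:E)%E).
  apply/funext => n; rewrite !integral_weighted_nnsfun//.
  by apply: eq_fsbigr => y _; rewrite W12.
by move=> c1; have := key _ _ P2 _ _ W20 mW2 mY2; exact: cvg_unique.
Qed.

End weighted_laws.

(** The indicators are replaced by the functions [g i] one index at a time, the
    remaining factors serving as the weight in [eq_integral_weighted].
    Finiteness of the expectations keeps that weight real. *)
Lemma expectation_prod_indep (R : realType) (disp : measure_display)
    (T : measurableType disp) (P : probability T R) (I : finType)
    (Y : I -> T -> R) :
  (forall i, measurable_fun setT (Y i)) ->
  (forall A : I -> set R, (forall i, measurable (A i)) ->
     (\int[P]_w (\prod_i \1_(A i) (Y i w))%:E =
      \prod_i \int[P]_w (\1_(A i) (Y i w))%:E)%E) ->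
  forall g : I -> R -> R, (forall i x, 0 <= g i x) ->
    (forall i, measurable_fun setT (g i)) ->
    (forall i, (\int[P]_w (g i (Y i w))%:E < +oo)%E) ->
    (\int[P]_w (\prod_i g i (Y i w))%:E = \prod_i \int[P]_w (g i (Y i w))%:E)%E.
Proof.
move=> mY ind g g0 mg gfin.
have mgY (g' : I -> R -> R) i : (forall i, measurable_fun setT (g' i)) ->
    measurable_fun setT (fun w => g' i (Y i w)).
  by move=> mg'; exact: (measurableT_comp (mg' i) (mY i)).
(* Induction on [m]: only the factors of rank at least [m] are indicators. *)
suff claim m (g' : I -> R -> R) : (forall i x, 0 <= g' i x) ->
    (forall i, measurable_fun setT (g' i)) ->
    (forall i, (\int[P]_w (g' i (Y i w))%:E < +oo)%E) ->
    (forall i, (m <= enum_rank i)%N ->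
       exists A : set R, measurable A /\ g' i = \1_A) ->
    (\int[P]_w (\prod_i g' i (Y i w))%:E = \prod_i \int[P]_w (g' i (Y i w))%:E)%E.
  by apply: (claim #|I|) => // i; rewrite leqNgt ltn_ord.
elim: m g' {g g0 mg gfin} => [|m IHm] g g0 mg gfin gi.
  have /choice[A mA] i : exists A : set R, measurable A /\ g i = \1_A.
    exact: gi.
  transitivity (\int[P]_w (\prod_i \1_(A i) (Y i w))%:E)%E.
    apply: eq_integral => w _; congr EFin; apply: eq_bigr => i _.
    by rewrite (mA i).2.
  rewrite ind; last by move=> i; case: (mA i).
  by apply: eq_bigr => i _; rewrite (mA i).2.
have [mI|Im] := ltnP m #|I|; last first.
  apply: IHm => // i mi; apply: gi; move: (ltn_ord (enum_rank i)).
  by rewrite ltnNge (leq_trans Im mi).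
pose k : I := enum_val (Ordinal mI).
pose upd (A : set R) i : R -> R := if i == k then \1_A else g i.
have E0 i : (0 <= \int[P]_w (g i (Y i w))%:E)%E.
  by apply: integral_ge0 => w _; rewrite lee_fin.
have Efin i : (\int[P]_w (g i (Y i w))%:E)%E \is a fin_num by rewrite ge0_fin_numE.
pose c : R := \prod_(i | i != k) fine (\int[P]_w (g i (Y i w))%:E).
have cE : (c%:E = \prod_(i | i != k) \int[P]_w (g i (Y i w))%:E)%E.
  by rewrite /c -prodEFin; apply: eq_bigr => i _; rewrite fineK.
have c0 : 0 <= c by apply: prodr_ge0 => i _; rewrite fine_ge0.
transitivity (\int[P]_w ((\prod_(i | i != k) g i (Y i w)) * g k (Y k w))%:E)%E.
  by apply: eq_integral => w _; rewrite (bigD1 k)//= mulrC.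
transitivity (\int[P]_w (c * g k (Y k w))%:E)%E; last first.
  under eq_integral do rewrite EFinM.
  rewrite ge0_integralZl_EFin//; last first.
  - exact/measurable_EFinP/mgY.
  - by move=> w _; rewrite lee_fin.
  by rewrite cE muleC [in RHS](bigD1 k).
have mW : measurable_fun setT (fun w => \prod_(i | i != k) g i (Y i w)).
  under eq_fun do rewrite big_mkcond/=.
  have := @measurable_prod _ _ _ setT _ (index_enum I)
    (fun i w => if i != k then g i (Y i w) else 1).
  by apply => i _; case: (i != k) => //; exact: mgY.
apply: eq_integral_weighted => //.
- by move=> w; apply: prodr_ge0 => i _.
- move=> A mA.
  have updk : upd A k = \1_A by rewrite /upd eqxx.
  have updN i : i != k -> upd A i = g i by rewrite /upd => /negbTE ->.
  have mupd i : measurable_fun setT (upd A i).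
    by rewrite /upd; case: ifP => // _; exact: measurable_indic.
  have fin1 : (\int[P]_w (\1_A (Y k w))%:E < +oo)%E.
    apply: (@le_lt_trans _ _ (\int[P]_w (cst 1%:E w))%E).
      apply: ge0_le_integral => //.
      - apply/measurable_EFinP/(measurableT_comp _ (mY k)).
        exact: measurable_indic.
      - by move=> w _; rewrite lee_fin indicE lern1 leq_b1.
    rewrite integral_cst//.
    by rewrite mul1e; apply: (le_lt_trans (probability_le1 _ _)); rewrite ?ltry.
  have fin_upd i : (\int[P]_w (upd A i (Y i w))%:E < +oo)%E.
    by rewrite /upd; case: ifP => [/eqP ->|_].
  have ge_upd i x : 0 <= upd A i x by rewrite /upd; case: ifP.
  have ind_upd i : (m <= enum_rank i)%N ->
      exists A' : set R, measurable A' /\ upd A i = \1_A'.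
    rewrite leq_eqVlt /upd => /orP[/eqP mi|mi].
      rewrite (_ : i == k) ?eqxx; first by exists A.
      by apply/eqP/enum_rank_inj/val_inj; rewrite /= /k enum_valK.
    case: ifP => _; first by exists A.
    exact: gi.
  have := IHm (upd A) ge_upd mupd fin_upd ind_upd.
  rewrite (bigD1 k)//= updk; under eq_bigr => i ik do rewrite updN//.
  rewrite -cE.
  under eq_integral => w _.
    rewrite (bigD1 k)//= updk mulrC.
    under eq_bigr => i ik do rewrite updN//.
    over.
  move=> ->; under [RHS]eq_integral do rewrite EFinM.
  rewrite ge0_integralZl_EFin//; first by rewrite muleC.
  apply/measurable_EFinP/(measurableT_comp _ (mY k)).
  exact: measurable_indic.
Qed.

(** * Exponential moments of Brownian increments *)

Lemma integral_indic_comp (R : realType) (disp : measure_display)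
    (T : measurableType disp) (P : {measure set T -> \bar R}) (Z : T -> R)
    (A : set R) :
  measurable_fun setT Z -> measurable A ->
  (\int[P]_w (\1_A (Z w))%:E = P (Z @^-1` A))%E.
Proof.
move=> mZ mA; rewrite -[in RHS](setIT (Z @^-1` A)) -integral_indic//.
by rewrite -[X in measurable X]setTI; exact: mZ.
Qed.

(** Completing the square turns the exponential times the centred density into
    a multiple of the density of a shifted Gaussian law. *)
Lemma expectation_expR_normal (R : realType) (disp : measure_display)
    (T : measurableType disp) (P : probability T R) (Z : T -> R) (v a : R) :
  measurable_fun setT Z -> 0 < v ->
  (forall A : set R, measurable A ->
     P (Z @^-1` A) = normal_prob 0 (Num.sqrt v) A) ->
  (\int[P]_w (expR (a * Z w))%:E = (expR (a ^+ 2 * v / 2))%:E)%E.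
Proof.
move=> mZ v0 lawZ.
have s0 : Num.sqrt v != 0 by rewrite gt_eqF// sqrtr_gt0.
have sv : Num.sqrt v ^+ 2 = v by rewrite sqr_sqrtr// ltW.
have mexp : measurable_fun setT (fun x : R => expR (a * x)).
  by apply: measurableT_comp => //; exact: measurable_funM.
transitivity (\int[P]_w (1 * expR (a * Z w))%:E)%E.
  by apply: eq_integral => w _; rewrite mul1r.
rewrite (@eq_integral_weighted R _ _ T P _ (@lebesgue_measure R)
  (cst 1) Z (normal_pdf 0 (Num.sqrt v)) id _ _ _ _ _ _ _
  (fun x => expR (a * x)))//.
- transitivity (\int[@lebesgue_measure R]_x
    ((expR (a ^+ 2 * v / 2))%:E * (normal_pdf (a * v) (Num.sqrt v) x)%:E))%E.
    apply: eq_integral => x _; rewrite -EFinM; congr EFin.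
    rewrite !normal_pdfE// mulrCA -[LHS]mulrA; congr *%R.
    rewrite /normal_fun -!expRD sv; congr expR.
    by field; rewrite gt_eqF.
  rewrite ge0_integralZl_EFin//.
  + by rewrite integral_normal_pdf mule1.
  + by move=> x _; rewrite lee_fin normal_pdf_ge0.
  + by apply/measurable_EFinP; exact: measurable_normal_pdf.
- by move=> x; rewrite normal_pdf_ge0.
- exact: measurable_normal_pdf.
- move=> A mA.
  transitivity (P (Z @^-1` A)).
    under eq_integral do rewrite mul1r.
    by rewrite integral_indic_comp.
  rewrite lawZ// /normal_prob [LHS]integral_mkcond.
  apply: eq_integral => x _; rewrite patchE indicE.
  by case: ifP => _; rewrite ?mulr1 ?mulr0.
Qed.

Section brownian_grid.
Context (R : realType) (disp : measure_display) (T : measurableType disp).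
Variables (P : probability T R) (d : nat) (B : 'I_d -> R -> T -> R).
Hypothesis hB : mutually_independent_BMs P B.

Lemma measurable_BM j u : 0 <= u -> measurable_fun setT (B j u).
Proof. by case: hB => /(_ j)[mB _ _ _ _] _; exact: mB. Qed.

(** For the sigma-algebra generated by the process, its values are measurable
    functions, hence so are their differences. *)
Lemma sigma_of_process_increments (W : R -> T -> R) (N : nat) (a b : 'I_N -> R)
    (A : 'I_N -> set R) :
  (forall i, 0 <= a i) -> (forall i, 0 <= b i) -> (forall i, measurable (A i)) ->
  sigma_of_process W
    (\bigcap_(i in [set: 'I_N]) (fun w => W (b i) w - W (a i) w) @^-1` A i).
Proof.
move=> a0 b0 mA.
pose G := [set E | exists t : R, exists A : set R,
         [/\ 0 <= t, measurable A & E = W t @^-1` A]].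
have mW u : 0 <= u ->
    measurable_fun setT (W u : g_sigma_algebraType G -> R).
  move=> u0 _ C mC; rewrite setTI; apply: sub_gen_smallest.
  by exists u, C.
suff : measurable (\bigcap_(i in [set: 'I_N])
    (fun w => W (b i) w - W (a i) w) @^-1` A i : set (g_sigma_algebraType G)).
  by [].
apply: fin_bigcap_measurable => // i _.
rewrite -[X in measurable X]setTI.
by apply: (measurable_funB (mW _ (b0 i)) (mW _ (a0 i))).
Qed.

(** Independence across motions comes from their generated sigma-algebras, and
    independence along each motion from its own increments. *)
Lemma indep_grid_increments (N : nat) (t : nat -> R)
    (A : 'I_N * 'I_d -> set R) :
  0 <= t 0%N -> (forall i, t i <= t i.+1) -> (forall p, measurable (A p)) ->
  (\int[P]_w (\prod_p \1_(A p) (B p.2 (t p.1.+1) w - B p.2 (t p.1) w))%:E =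
   \prod_p \int[P]_w (\1_(A p) (B p.2 (t p.1.+1) w - B p.2 (t p.1) w))%:E)%E.
Proof.
move=> t0 tS mA; case: hB => hBM hind.
have tge0 i : 0 <= t i by elim: i => // i /le_trans; exact.
pose Y (p : 'I_N * 'I_d) w := B p.2 (t p.1.+1) w - B p.2 (t p.1) w.
have mY p : measurable_fun setT (Y p).
  by apply: measurable_funB; apply: measurable_BM.
pose E j := \bigcap_(i in [set: 'I_N]) (Y (i, j) @^-1` A (i, j)).
have mE j : measurable (E j).
  apply: fin_bigcap_measurable => // i _.
  by rewrite -[X in measurable X]setTI; exact: mY.
transitivity (P (\bigcap_(j in [set: 'I_d]) E j)).
  rewrite -[in RHS](setIT (\bigcap_(j in _) E j)) -integral_indic//; last first.
    exact: fin_bigcap_measurable.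
  apply: eq_integral => w _; congr EFin; rewrite indicE.
  have [/set_mem wE|/negP wE] := boolP (w \in _).
    rewrite big1// => -[i j] _; rewrite indicE mem_set//.
    by have := wE j Logic.I i Logic.I.
  have [p pA] : exists p, ~ A p (Y p w).
    apply: contrapT => /forallNP Yw; apply: wE; rewrite inE => j _ i _.
    exact: contrapT (Yw (i, j)).
  by rewrite (bigD1 p)//= indicE memNset// mul0r.
rewrite hind; last by move=> j; apply: sigma_of_process_increments.
under eq_bigr => j _.
  have [_ _ _ /(_ N t t0 tS) indj _] := hBM j.
  rewrite (indj (fun i => A (i, j)))//.
  over.
rewrite exchange_big/= pair_big/=.
by apply: eq_bigr => p _; rewrite (integral_indic_comp P (mY p))// -surjective_pairing.
Qed.

Lemma expectation_expR_increment j (a u v : R) : 0 <= u -> u <= v ->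
  (\int[P]_w (expR (a * (B j v w - B j u w)))%:E =
   (expR (a ^+ 2 * (v - u) / 2))%:E)%E.
Proof.
move=> u0; rewrite le_eqVlt => /predU1P[<-|uv].
  under eq_integral do rewrite subrr mulr0 expR0.
  rewrite subrr mulr0 mul0r expR0 (_ : (fun=> 1%:E) = cst 1%E)//.
  rewrite integral_cst// mul1e; exact: probability_setT.
apply: expectation_expR_normal; rewrite ?subr_gt0//.
- by apply: measurable_funB; apply: measurable_BM => //; exact: ltW (le_lt_trans u0 uv).
- by case: hB => /(_ j)[_ _ law _ _] _ A mA; exact: law.
Qed.

Lemma expectation_expR_grid (N : nat) (t : nat -> R) (a : nat -> 'I_d -> R) :
  0 <= t 0%N -> (forall i, t i <= t i.+1) ->
  (\int[P]_w (expR (\sum_(i < N) \sum_j a i j * (B j (t i.+1) w - B j (t i) w)))%:E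
   = (expR ((\sum_(i < N) \sum_j a i j ^+ 2 * (t i.+1 - t i)) / 2))%:E)%E.
Proof.
move=> t0 tS.
have tge0 i : 0 <= t i by elim: i => // i /le_trans; exact.
pose Y (p : 'I_N * 'I_d) w := B p.2 (t p.1.+1) w - B p.2 (t p.1) w.
have mY p : measurable_fun setT (Y p).
  by apply: measurable_funB; apply: measurable_BM.
pose g (p : 'I_N * 'I_d) x := expR (a p.1 p.2 * x).
have Eg p : (\int[P]_w (g p (Y p w))%:E =
    (expR (a p.1 p.2 ^+ 2 * (t p.1.+1 - t p.1) / 2))%:E)%E.
  exact: expectation_expR_increment.
transitivity (\int[P]_w (\prod_p g p (Y p w))%:E)%E.
  by apply: eq_integral => w _; rewrite pair_big/= expR_sum.
rewrite expectation_prod_indep//.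
- under eq_bigr do rewrite Eg.
  by rewrite prodEFin -expR_sum pair_big/= mulr_suml.
- by move=> A mA; exact: indep_grid_increments.
- by move=> p x; exact: expR_ge0.
- by move=> p; apply: measurableT_comp => //; exact: measurable_funM.
- by move=> p; rewrite Eg ltry.
Qed.

End brownian_grid.

(** * Deterministic step functions *)

(** The deterministic counterpart of a simple process: times may coincide, and
    those of index larger than [step_size] are meaningless. *)
Record step (R : realType) (n d : nat) := Step {
  step_size : nat;
  step_time : nat -> R;
  step_coef : nat -> 'M[R]_(n, d);
  step_time_nd : forall k, (k < step_size)%N -> step_time k <= step_time k.+1;
  step_time_ge0 : forall k, (k <= step_size)%N -> 0 <= step_time k }.

Section step_functions.
Context (R : realType) (n d : nat).
Implicit Type phi : step R n d.

Definition step_val phi (s : R) : 'M[R]_(n, d) :=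
  \sum_(k < step_size phi | step_time phi k < s <= step_time phi k.+1)
    step_coef phi k.

Definition step_int (disp : measure_display) (T : measurableType disp)
    (B : 'I_d -> R -> T -> R) phi (w : T) : 'cV[R]_n :=
  \sum_(k < step_size phi) step_coef phi k *m
    (BM_vec B (step_time phi k.+1) w - BM_vec B (step_time phi k) w).

Definition adapted_grid (N : nat) (t : nat -> R) phi :=
  forall k, (k <= step_size phi)%N ->
    t 0%N <= step_time phi k <= t N /\
    forall i, (i < N)%N -> step_time phi k <= t i \/ t i.+1 <= step_time phi k.

Lemma common_grid phi psi : exists N t,
  [/\ 0 <= t 0%N, forall i, t i <= t i.+1, adapted_grid N t phi
    & adapted_grid N t psi].
Proof.
pose s0 := mkseq (step_time phi) (step_size phi).+1 ++
           mkseq (step_time psi) (step_size psi).+1.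
pose s := sort <=%O s0.
pose N := (size s).-1.
have sE x : (x \in s) = (x \in s0) by rewrite mem_sort.
have s_gt0 : (0 < size s)%N by rewrite size_sort size_cat size_mkseq.
have N_lt : (N < size s)%N by rewrite prednK.
have s_sorted : sorted <=%O s by exact: sort_le_sorted.
(* Independence of increments is stated for grids indexed by all of [nat]: the
   grid stays at its last point from [N] on. *)
pose t i := nth 0 s (minn i N).
have idx i : (minn i N < size s)%N by rewrite (leq_ltn_trans _ N_lt)// geq_minr.
have nd i j : (i <= j)%N -> (j < size s)%N -> nth 0 s i <= nth 0 s j.
  move=> ij js; apply: (sorted_leq_nth le_trans lexx) => //.
  by rewrite inE (leq_ltn_trans ij).
have s_ge0 x : x \in s -> 0 <= x.
  rewrite sE mem_cat => /orP[] /mapP[k]; rewrite mem_iota/= add0n ltnS => ks ->;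
    exact: step_time_ge0.
have adapt x : x \in s -> t 0%N <= x <= t N /\
    forall i, (i < N)%N -> x <= t i \/ t i.+1 <= x.
  move=> xs; pose k := index x s.
  have ks : (k < size s)%N by rewrite index_mem.
  have kN : (k <= N)%N by rewrite -ltnS prednK.
  have xE : x = nth 0 s k by rewrite nth_index.
  split; first by rewrite /t min0n minnn xE !nd.
  move=> i iN; rewrite /t (minn_idPl (ltnW iN)) (minn_idPl iN) xE.
  have [ki|ik] := leqP k i; [left|right]; apply: nd => //.
  exact: ltn_trans N_lt.
exists N, t; split.
- by apply: s_ge0; rewrite mem_nth.
- move=> i; apply: nd => //.
  by rewrite leq_min geq_minr andbT (leq_trans (geq_minl _ _)).
- move=> k kphi; apply: adapt; rewrite sE mem_cat; apply/orP; left.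
  by apply/mapP; exists k => //; rewrite mem_iota.
- move=> k kpsi; apply: adapt; rewrite sE mem_cat; apply/orP; right.
  by apply/mapP; exists k => //; rewrite mem_iota.
Qed.

(** Clipping the grid to the segment from [a] to [b] produces a telescoping sum,
    and a cell that does not straddle [a] or [b] is either left unchanged by
    clipping or collapsed to a point. *)
Lemma grid_telescope (V : zmodType) (F : R -> V) (N : nat) (t : nat -> R)
    (a b : R) :
  (forall i, t i <= t i.+1) -> a <= b -> t 0%N <= a -> b <= t N ->
  (forall i, (i < N)%N -> a <= t i \/ t i.+1 <= a) ->
  (forall i, (i < N)%N -> b <= t i \/ t i.+1 <= b) ->
  \sum_(i < N | a < t i.+1 <= b) (F (t i.+1) - F (t i)) = F b - F a.
Proof.
move=> tS ab t0a btN ga gb.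
pose clip x := Num.min b (Num.max a x).
have -> : F b - F a = F (clip (t N)) - F (clip (t 0%N)).
  by rewrite /clip (max_idPl t0a) (min_idPr ab) (max_idPr (le_trans ab btN))
    (min_idPl btN).
rewrite -(telescope_sumr (fun i => F (clip (t i))) (leq0n N)) big_mkord.
rewrite big_mkcond/=.
apply: eq_bigr => i _.
have [ai|ai] := ga i (ltn_ord i); last first.
  rewrite ltNge ai/= /clip !(max_idPl _) ?subrr//.
  exact: le_trans (tS i) ai.
have [bi|bi] := gb i (ltn_ord i); last first.
  rewrite bi andbT /clip (max_idPr ai) (max_idPr (le_trans ai (tS i))).
  rewrite (min_idPr bi) (min_idPr (le_trans (tS i) bi)).
  case: ltP => // ia; rewrite (_ : t i.+1 = t i) ?subrr//.
  by apply/le_anti; rewrite tS (le_trans ia ai).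
rewrite /clip (max_idPr ai) (max_idPr (le_trans ai (tS i))).
rewrite (min_idPl bi) (min_idPl (le_trans bi (tS i))) subrr.
case: ifP => // /andP[_ ib]; rewrite (_ : t i.+1 = t i) ?subrr//.
by apply/le_anti; rewrite tS (le_trans ib bi).
Qed.

(** A step function is constant on each cell of a grid that contains its jumps,
    so its integral can be computed on that grid. *)
Lemma step_int_grid (disp : measure_display) (T : measurableType disp)
    (B : 'I_d -> R -> T -> R) N t phi w :
  (forall i, t i <= t i.+1) -> adapted_grid N t phi ->
  step_int B phi w = \sum_(i < N) step_val phi (t i.+1) *m
    (BM_vec B (t i.+1) w - BM_vec B (t i) w).
Proof.
move=> tS gphi; rewrite /step_int /step_val.
under [RHS]eq_bigr do rewrite mulmx_suml big_mkcond.
rewrite exchange_big/=; apply: eq_bigr => k _.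
have [/andP[tk _] gk] := gphi k (ltnW (ltn_ord k)).
have [/andP[_ tk1] gk1] := gphi k.+1 (ltn_ord k).
rewrite -(@grid_telescope _ (fun u => BM_vec B u w) N t)//; last first.
  exact: step_time_nd.
by rewrite mulmx_sumr big_mkcond.
Qed.

Lemma step_val_cell N t phi i x : adapted_grid N t phi -> (i < N)%N ->
  t i < x <= t i.+1 -> step_val phi x = step_val phi (t i.+1).
Proof.
move=> gphi iN /andP[ix xi]; rewrite /step_val; apply: eq_bigl => k.
have [_ /(_ i iN) gk] := gphi k (ltnW (ltn_ord k)).
have [_ /(_ i iN) gk1] := gphi k.+1 (ltn_ord k).
congr andb.
  case: gk => h; first by rewrite (le_lt_trans h ix) (lt_le_trans (le_lt_trans h ix) xi).
  by rewrite !ltNge h (le_trans xi h).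
case: gk1 => h; last by rewrite h (le_trans xi h).
by rewrite !leNgt (le_lt_trans h ix) (lt_le_trans (le_lt_trans h ix) xi).
Qed.

Lemma measurable_step_val phi i j : measurable_fun setT (fun s : R => step_val phi s i j).
Proof.
have -> : (fun s => step_val phi s i j) = (fun s => \sum_(k < step_size phi)
    step_coef phi k i j * \1_(`]step_time phi k, step_time phi k.+1]) s).
  apply/funext => s; rewrite /step_val summxE big_mkcond; apply: eq_bigr => k _.
  rewrite indicE mem_setE in_itv/=.
  by case: ifP => _; rewrite ?mulr1 ?mulr0.
by apply: measurable_sum => k; exact: measurable_funM.
Qed.

End step_functions.

Lemma sum_cells_le_integral (R : realType) (N : nat) (t : nat -> R) (h : R -> R) :
  0 <= t 0%N -> (forall i, t i <= t i.+1) -> (forall x, 0 <= h x) ->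
  measurable_fun setT h ->
  (forall i x, (i < N)%N -> t i < x <= t i.+1 -> h x = h (t i.+1)) ->
  ((\sum_(i < N) h (t i.+1) * (t i.+1 - t i))%:E <=
   \int[lebesgue_measure]_(x in `[0%R, +oo[) (h x)%:E)%E.
Proof.
move=> t0 tS h0 mh hc.
have mhE (D : set R) : measurable_fun D (fun x => (h x)%:E).
  by apply/measurable_EFinP; exact: measurable_funTS.
have t0N M : t 0%N <= t M by elim: M => // M /le_trans; exact.
apply: (@le_trans _ _ (\int[lebesgue_measure]_(x in `]t 0%N, t N]) (h x)%:E)%E);
    last first.
  apply: ge0_subset_integral => //.
  - exact: mhE.
  - by move=> x _; rewrite lee_fin.
  - by move=> x /=; rewrite !in_itv/= andbT => /andP[/(le_lt_trans t0)/ltW].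
elim: N hc => [|N IH] hc; first by rewrite big_ord0; apply: integral_ge0 => x _;
  rewrite lee_fin.
rewrite big_ord_recr/= EFinD.
rewrite (@itv_bndbnd_setU _ _ _ (BRight (t N)))//; last first.
- by rewrite bnd_simp tS.
- by rewrite bnd_simp.
rewrite ge0_integral_setU//=; last first.
- apply/disj_setPS => x [] /=; rewrite !in_itv/= => /andP[_ xN] /andP[Nx _].
  by move: (lt_le_trans Nx xN); rewrite ltxx.
- by move=> x _; rewrite lee_fin.
- exact: mhE.
- apply: leeD; first by apply: IH => i x iN; apply: hc; rewrite ltnS ltnW.
  rewrite (eq_integral (cst (h (t N.+1))%:E)); last first.
    by move=> x /set_mem/=; rewrite in_itv/= => /(hc N x (ltnSn N)) ->.
  rewrite integral_cst//= lebesgue_measure_itv/= lte_fin.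
  case: ltP => tt; first by rewrite -EFinB -EFinM.
  by rewrite (_ : t N.+1 = t N) ?subrr ?mulr0 ?mule0//; apply/le_anti; rewrite tS tt.
Qed.

(** * Gaussian tails for integrals of step functions *)

Section frobenius.
Context (R : realType).

Lemma fnorm_sqr (m n : nat) (A : 'M[R]_(m, n)) :
  fnorm A ^+ 2 = \sum_(i < m) \sum_(j < n) A i j ^+ 2.
Proof.
rewrite /fnorm sqr_sqrtr//; apply: sumr_ge0 => i _; apply: sumr_ge0 => j _.
exact: sqr_ge0.
Qed.

Lemma fnorm_ge0 (m n : nat) (A : 'M[R]_(m, n)) : 0 <= fnorm A.
Proof. exact: sqrtr_ge0. Qed.

Lemma row_le_fnorm (m n : nat) (A : 'M[R]_(m, n)) r :
  \sum_(j < n) A r j ^+ 2 <= fnorm A ^+ 2.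
Proof.
rewrite fnorm_sqr (bigD1 r)//= lerDl; apply: sumr_ge0 => i _.
by apply: sumr_ge0 => j _; exact: sqr_ge0.
Qed.

Lemma entry_le_fnorm (m n : nat) (A : 'M[R]_(m, n)) i j :
  A i j ^+ 2 <= fnorm A ^+ 2.
Proof.
apply: le_trans (row_le_fnorm A i); rewrite (bigD1 j)//= lerDl.
by apply: sumr_ge0 => k _; exact: sqr_ge0.
Qed.

Lemma fnorm_sqrN (m n : nat) (A : 'M[R]_(m, n)) : fnorm (- A) ^+ 2 = fnorm A ^+ 2.
Proof.
rewrite !fnorm_sqr; apply: eq_bigr => i _; apply: eq_bigr => j _.
by rewrite mxE sqrrN.
Qed.

Lemma fnorm_sqr0 (m n : nat) : fnorm (0 : 'M[R]_(m, n)) ^+ 2 = 0.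
Proof.
rewrite fnorm_sqr big1// => i _; rewrite big1// => j _.
by rewrite mxE expr0n.
Qed.

Lemma fnorm_sqrD_le (m n : nat) (A B : 'M[R]_(m, n)) :
  fnorm (A + B) ^+ 2 <= 2 * fnorm A ^+ 2 + 2 * fnorm B ^+ 2.
Proof.
rewrite !fnorm_sqr !mulr_sumr -big_split/=; apply: ler_sum => i _.
rewrite !mulr_sumr -big_split/=; apply: ler_sum => j _.
by rewrite mxE; have := sqr_ge0 (A i j - B i j); nra.
Qed.

(** Cauchy-Schwarz, from Lagrange's identity. *)
Lemma sqr_sum_mul_le (n : nat) (a b : 'I_n -> R) :
  (\sum_k a k * b k) ^+ 2 <= (\sum_k a k ^+ 2) * (\sum_k b k ^+ 2).
Proof.
rewrite -subr_ge0.
have -> : (\sum_k a k ^+ 2) * (\sum_k b k ^+ 2) - (\sum_k a k * b k) ^+ 2 =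
    \sum_k \sum_l (a k * b l - a l * b k) ^+ 2 / 2.
  rewrite (_ : \sum_k \sum_l _ =
     \sum_k \sum_l (a k ^+ 2 * b l ^+ 2 / 2 + a l ^+ 2 * b k ^+ 2 / 2 -
        (a k * b k) * (a l * b l))); last first.
    by apply: eq_bigr => k _; apply: eq_bigr => l _; field.
  under [RHS]eq_bigr do rewrite sumrB big_split/=.
  rewrite sumrB big_split/= [X in _ = _ + X - _]exchange_big/= -big_split/=.
  rewrite expr2 !mulr_suml; congr (_ - _); apply: eq_bigr => k _; last first.
    by rewrite mulr_sumr.
  by rewrite mulr_sumr -big_split/=; apply: eq_bigr => l _; field.
by apply: sumr_ge0 => k _; apply: sumr_ge0 => l _; rewrite divr_ge0// sqr_ge0.
Qed.

Lemma fnorm_sqrM_le (m n p : nat) (A : 'M[R]_(m, n)) (B : 'M[R]_(n, p)) :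
  fnorm (A *m B) ^+ 2 <= fnorm A ^+ 2 * fnorm B ^+ 2.
Proof.
rewrite !fnorm_sqr mulr_suml; apply: ler_sum => i _.
rewrite [X in _ * X]exchange_big/= mulr_sumr; apply: ler_sum => j _.
by rewrite mxE; exact: sqr_sum_mul_le.
Qed.

End frobenius.

Lemma markov_le (R : realType) (disp : measure_display)
    (T : measurableType disp) (P : probability T R) (E : set T) (F : T -> R)
    (K e : R) :
  measurable E -> measurable_fun setT F -> (forall w, 0 <= F w) -> 0 < K ->
  (forall w, E w -> K <= F w) -> (\int[P]_w (F w)%:E <= e%:E)%E ->
  (P E <= (e / K)%:E)%E.
Proof.
move=> mE mF F0 K0 KF Fe; rewrite EFinM muleC lee_pdivlMl//.
apply: le_trans Fe; rewrite -[X in P X]setIT -integral_indic//.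
rewrite -(ge0_integralZl_EFin P measurableT) ?(ltW K0)//; last first.
  exact/measurable_EFinP.
apply: ge0_le_integral => //.
- by move=> w _; rewrite -EFinM lee_fin mulr_ge0// ltW.
- by apply: measurable_funeM; exact/measurable_EFinP.
- exact/measurable_EFinP.
- move=> w _; rewrite -EFinM lee_fin indicE.
  by have [/set_mem /KF|_] := boolP (w \in E); rewrite ?mulr1 ?mulr0.
Qed.

Section superlevel_sets.
Context (R : realType) (disp : measure_display) (T : measurableType disp).

Lemma measurable_gt (U : T -> R) (a : R) : measurable_fun setT U ->
  measurable [set w | a < U w].
Proof.
move=> mU; rewrite (_ : [set w | _] = U @^-1` `]a, +oo[).
  by rewrite -[X in measurable X]setTI; exact: mU.
by apply/seteqP; split=> w /=; rewrite in_itv/= andbT.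
Qed.

Lemma measurable_gt_norm (U : T -> R) (a : R) : measurable_fun setT U ->
  measurable [set w | a < `|U w|].
Proof. by move=> mU; apply: measurable_gt; exact: measurableT_comp. Qed.

End superlevel_sets.

Section gaussian_tails.
Context (R : realType) (disp : measure_display) (T : measurableType disp).
Variable P : probability T R.

Lemma exponential_markov (Z : T -> R) (l a K : R) :
  measurable_fun setT Z -> 0 <= l ->
  (\int[P]_w (expR (l * Z w))%:E <= K%:E)%E ->
  (P [set w | (a < Z w)%R] <= (expR (- l * a) * K)%:E)%E.
Proof.
move=> mZ l0 EK.
have mexp : measurable_fun setT (fun w => expR (l * Z w)).
  by apply: measurableT_comp => //; exact: measurable_funM.
have := markov_le (measurable_gt a mZ) mexp (fun w => expR_ge0 _)
  (expR_gt0 (l * a)) _ EK.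
rewrite mulNr expRN [X in (_ <= X%:E)%E]mulrC; apply => w /= aw.
by rewrite ler_expR ler_wpM2l// ltW.
Qed.

Context (n d : nat) (B : 'I_d -> R -> T -> R).
Hypothesis hB : mutually_independent_BMs P B.
Implicit Types phi psi : step R n d.

Lemma measurable_step_int phi i :
  measurable_fun setT (fun w => step_int B phi w i 0).
Proof.
rewrite (_ : (fun w => _) = (fun w => \sum_(k < step_size phi) \sum_j
    step_coef phi k i j * (B j (step_time phi k.+1) w - B j (step_time phi k) w))).
  apply: measurable_sum => k; apply: measurable_sum => j.
  apply: measurable_funM => //; apply: measurable_funB; apply: (measurable_BM hB).
    exact: step_time_ge0.
  by apply: step_time_ge0; exact: ltnW.
apply/funext => w; rewrite /step_int summxE; apply: eq_bigr => k _.
by rewrite mxE; apply: eq_bigr => j _; rewrite !mxE.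
Qed.

(** On a common grid the difference of the two integrals is a single linear
    combination of independent increments, and its variance is at most the
    squared distance in L2 of the two step functions. *)
Lemma expectation_expR_step phi psi (a v : R) r :
  (\int[lebesgue_measure]_(s in `[0%R, +oo[)
     (fnorm (step_val phi s - step_val psi s) ^+ 2)%:E <= v%:E)%E ->
  (\int[P]_w (expR (a * (step_int B phi w r 0 - step_int B psi w r 0)))%:E
    <= (expR (a ^+ 2 * v / 2))%:E)%E.
Proof.
have [N [t [t0 tS gphi gpsi]]] := common_grid phi psi.
pose D i := step_val phi (t i.+1) - step_val psi (t i.+1).
move=> hv; under eq_integral => w _.
  rewrite (_ : a * _ = \sum_(i < N) \sum_j
      (a * D i r j) * (B j (t i.+1) w - B j (t i) w)); last first.
    rewrite (step_int_grid _ _ tS gphi) (step_int_grid _ _ tS gpsi).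
    rewrite !summxE -sumrB mulr_sumr; apply: eq_bigr => i _.
    rewrite !mxE -sumrB mulr_sumr; apply: eq_bigr => j _.
    by rewrite !mxE; ring.
  over.
rewrite (expectation_expR_grid hB N (fun i j => a * D i r j) t0 tS).
rewrite lee_fin ler_expR ler_pM2r//.
under eq_bigr do under eq_bigr do rewrite exprMn -mulrA.
under eq_bigr do rewrite -mulr_sumr -mulr_suml.
rewrite -mulr_sumr ler_wpM2l ?sqr_ge0//.
pose h s := fnorm (step_val phi s - step_val psi s) ^+ 2.
apply: (@le_trans _ _ (\sum_(i < N) h (t i.+1) * (t i.+1 - t i))).
  apply: ler_sum => i _; rewrite ler_wpM2r ?subr_ge0//.
  exact: row_le_fnorm.
rewrite -lee_fin; apply: le_trans hv; apply: sum_cells_le_integral => //.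
- by move=> x; exact: sqr_ge0.
- rewrite /h; under eq_fun do rewrite fnorm_sqr.
  apply: measurable_sum => i; apply: measurable_sum => j.
  apply: measurable_funX; under eq_fun do rewrite !mxE.
  by apply: measurable_funB; exact: measurable_step_val.
- by move=> i x iN xi; rewrite /h (step_val_cell gphi iN xi) (step_val_cell gpsi iN xi).
Qed.

Lemma step_int_tail phi psi (a v l : R) r : 0 <= l ->
  (\int[lebesgue_measure]_(s in `[0%R, +oo[)
     (fnorm (step_val phi s - step_val psi s) ^+ 2)%:E <= v%:E)%E ->
  (P [set w | (a < `|step_int B phi w r 0 - step_int B psi w r 0|)%R]
    <= (2 * expR (l ^+ 2 * v / 2 - l * a))%:E)%E.
Proof.
move=> l0 hv; set K := expR _.
pose Z phi psi w := step_int B phi w r 0 - step_int B psi w r 0.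
have mZ f g : measurable_fun setT (Z f g).
  by apply: measurable_funB; exact: measurable_step_int.
have mS f g : measurable [set w | a < Z f g w] by exact: measurable_gt.
rewrite (_ : [set w | _] = [set w | a < Z phi psi w] `|` [set w | a < Z psi phi w]);
    last first.
  have E w : (a < `|Z phi psi w|) = (a < Z phi psi w) || (a < Z psi phi w).
    by rewrite lter_normr /Z opprB.
  by apply/seteqP; split=> w /=; rewrite -/(Z phi psi w) E => /orP.
apply: le_trans (measureU2 _ _ _) _ => //.
have one f g : (\int[lebesgue_measure]_(s in `[0%R, +oo[)
     (fnorm (step_val f s - step_val g s) ^+ 2)%:E <= v%:E)%E ->
    (P [set w | (a < Z f g w)%R] <= K%:E)%E.
  move=> hfg; rewrite /K addrC expRD -mulNr; apply: exponential_markov => //.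
  exact: expectation_expR_step.
have hv' : (\int[lebesgue_measure]_(s in `[0%R, +oo[)
     (fnorm (step_val psi s - step_val phi s) ^+ 2)%:E <= v%:E)%E.
  by under eq_integral do rewrite -fnorm_sqrN opprB; exact: hv.
have -> : 2 * K = K + K by ring.
by rewrite EFinD; exact: leeD (one _ _ hv) (one _ _ hv').
Qed.

End gaussian_tails.

(** * Stochastic integrals of deterministic integrands *)

(** Otherwise a constant larger than the integral would be a simple function
    below [F]. *)
Lemma exists_le_expectation (R : realType) (disp : measure_display)
    (T : measurableType disp) (P : probability T R) (F : T -> \bar R) (e : R) :
  (forall w, 0 <= F w)%E -> 0 < e -> exists w, (F w <= \int[P]_w F w + e%:E)%E.
Proof.
move=> F0 e0; apply: contrapT => /forallNP h.
have {}h w : (\int[P]_w F w + e%:E < F w)%E by rewrite ltNge; apply/negP/h.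
have I0 : (0 <= \int[P]_w F w)%E by apply: integral_ge0 => w _.
have [w _] : [set: T] !=set0.
  apply/set0P/negP => /eqP T0; have := probability_setT P.
  by rewrite T0 measure0 => /eqP; rewrite eq_sym onee_eq0.
have Ifin : (\int[P]_w F w)%E \is a fin_num.
  rewrite ge0_fin_numE// ltNge leye_eq; apply/negP => /eqP Iy.
  by have := h w; rewrite Iy addye// ltNge leey.
pose m := fine (\int[P]_w F w) + e.
have m0 : 0 <= m by rewrite addr_ge0 ?fine_ge0// ltW.
have : (m%:E <= \int[P]_w F w)%E.
  rewrite ge0_integralTE//; apply: ereal_sup_ubound.
  exists (cst_nnsfun T (NngNum m0)) => [x|].
    by have := ltW (h x); rewrite /= /m EFinD fineK.
  have := sintegral_EFin_cst P setT (NngNum m0).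
  rewrite patch_setT => ->.
  by rewrite -[RHS]mule1; congr (_ * _)%E; exact: probability_setT.
by rewrite /m EFinD fineK// -[leRHS]adde0 leeD2lE// lee_fin leNgt e0.
Qed.

Section wiener.
Context (R : realType) (disp : measure_display) (T : measurableType disp).
Variables (P : probability T R) (n d : nat) (B : 'I_d -> R -> T -> R).

(** The square of the distance in L2, which is what variances are made of. *)
Definition L2_dist (g h : R -> 'M[R]_(n, d)) : \bar R :=
  (\int[lebesgue_measure]_(s in `[0%R, +oo[) (fnorm (g s - h s) ^+ 2)%:E)%E.

(** [Z] is the stochastic integral over the half-line of the deterministic
    integrand [g], described through deterministic step functions only, so that
    every approximant is Gaussian. *)
Definition wiener (g : R -> 'M[R]_(n, d)) (Z : T -> 'cV[R]_n) :=
  (forall i, measurable_fun setT (fun w => Z w i 0)) /\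
  forall e, 0 < e -> exists phi : step R n d,
    (L2_dist (step_val phi) g <= e%:E)%E /\
    (\int[P]_w (fnorm (step_int B phi w - Z w) ^+ 2)%:E <= e%:E)%E.

Definition cut (D : set R) (g : R -> 'M[R]_(n, d)) (s : R) : 'M[R]_(n, d) :=
  if s \in D then g s else 0.

Lemma cvge0_lt (u : nat -> \bar R) (e : R) : u @ \oo --> 0%E -> 0 < e ->
  \forall k \near \oo, (u k < e%:E)%E.
Proof.
move=> u0 e0; apply: (u0 [set x | (x < e%:E)%E]).
by apply: open_nbhs_nbhs; split; [exact: open_ereal_lt_ereal|rewrite /= lte_fin].
Qed.

Lemma measurable_cst_filtration t (c : R) (A : set R) :
  natural_filtration B t ((fun _ : T => c) @^-1` A).
Proof.
have -> : (fun _ : T => c) @^-1` A = if c \in A then setT else set0.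
  apply/seteqP; split => w /=; first by move=> cA; rewrite mem_set.
  by case: ifPn => // /set_mem.
pose G := [set E | exists j : 'I_d, exists u : R, exists A : set R,
         [/\ 0 <= u <= t, measurable A & E = B j u @^-1` A]].
suff : measurable ((if c \in A then setT else set0) : set (g_sigma_algebraType G)).
  by [].
by case: ifP.
Qed.

(** The existence clause of the integral only provides random simple processes.
    Freezing the coefficients of the k-th one at a sample point where the
    approximation error does not exceed its mean gives a deterministic
    approximation that is just as good. *)
Lemma wiener_ito (D : set R) (g : R -> 'M[R]_(n, d)) (Z : T -> 'cV[R]_n) :
  is_interval D -> (forall s, D s -> 0 <= s) ->
  is_ito_integral P B D g Z -> wiener (cut D g) Z.
Proof.
move=> iD D0 [mZ [S [admS cvS]] convZ]; split=> // e e0.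
pose F k w := (\int[lebesgue_measure]_(s in D)
     (fnorm (sp_val (S k) s w - g s) ^+ 2)%:E)%E.
have F0 k w : (0 <= F k w)%E.
  by apply: integral_ge0 => s _; rewrite lee_fin sqr_ge0.
have /choice[om omP] k : exists w, (F k w <= \int[P]_w F k w + (k.+1%:R^-1)%:E)%E.
  by apply: exists_le_expectation.
pose S' k := SimpleProcess (sp_size (S k)) (sp_time (S k))
  (fun i (_ : T) => sp_coef (S k) i (om k)).
have F'E k : (\int[P]_w \int[lebesgue_measure]_(s in D)
     (fnorm (sp_val (S' k) s w - g s) ^+ 2)%:E = F k (om k))%E.
  rewrite (_ : (fun w => _) = cst (F k (om k)))//.
  rewrite integral_cst// -[RHS]mule1; congr (_ * _)%E.
  exact: probability_setT.
have cvF : F k (om k) @[k --> \oo] --> 0%E.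
  apply: (@squeeze_cvge _ _ _ _ (cst 0%E) _
      (fun k => \int[P]_w F k w + (k.+1%:R^-1)%:E)%E).
  - by near=> k; rewrite F0 omP.
  - exact: cvg_cst.
  - rewrite -[X in _ --> X](adde0 0%E); apply: cvgeD => //.
    exact: cvge_harmonic.
have aS' : approximates P B D g S'.
  split=> [k|]; last by under eq_fun do rewrite F'E.
  have [h1 h2 _ [M hM]] := admS k; split=> //.
    by move=> i ik a b A mA; exact: measurable_cst_filtration.
  by exists M => i ik w; exact: hM.
have cvZ := convZ _ aS'.
have [k [kF kZ]] : exists k, (F k (om k) < e%:E)%E /\
    (\int[P]_w (fnorm (sp_int B (S' k) w - Z w) ^+ 2)%:E < e%:E)%E.
  have [N _ h] := filterI (cvge0_lt cvF e0) (cvge0_lt cvZ e0).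
  by exists N; apply: h => /=.
have [ndk Dk _ _] := admS k.
pose phi := @Step R n d (sp_size (S k)) (sp_time (S k))
  (fun i => sp_coef (S k) i (om k)) ndk (fun i ik => D0 _ (Dk i ik)).
exists phi; split; last exact: ltW.
apply: le_trans (ltW kF); rewrite /L2_dist /F.
rewrite integral_mkcond [leRHS]integral_mkcond.
rewrite (_ : _ \_ `[0, +oo[ = (fun s => (fnorm (sp_val (S k) s (om k) - g s) ^+ 2)%:E)
   \_ D)//.
apply/funext => s; rewrite !patchE /cut.
have [sD|sD] := boolP (s \in D).
  have s0 := D0 s (set_mem sD).
  by rewrite (mem_set (_ : `[0, +oo[%classic s))//= in_itv/= s0.
case: ifP => // _.
rewrite (_ : step_val phi s = 0) ?subr0 ?fnorm_sqr0//.
rewrite /step_val big1// => i /andP[i1 i2]; exfalso; move/negP: sD; apply.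
apply: mem_set; apply: (iD _ _ (Dk i (ltnW (ltn_ord i))) (Dk i.+1 (ltn_ord i))).
by rewrite (ltW i1).
Unshelve. all: by end_near. Qed.

End wiener.

Section wiener_tail.
Context (R : realType) (disp : measure_display) (T : measurableType disp).
Variables (P : probability T R) (n d : nat) (B : 'I_d -> R -> T -> R).
Hypothesis hB : mutually_independent_BMs P B.

Definition mx_measurable (g : R -> 'M[R]_(n, d)) :=
  forall i j, measurable_fun (`[0%R, +oo[ : set R) (fun s => g s i j).

Lemma measurable_fnorm_sqr (D : set R) (g : R -> 'M[R]_(n, d)) :
  (forall i j, measurable_fun D (fun s => g s i j)) ->
  measurable_fun D (fun s => fnorm (g s) ^+ 2).
Proof.
move=> mg; under eq_fun do rewrite fnorm_sqr.
by apply: measurable_sum => i; apply: measurable_sum => j; exact: measurable_funX.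
Qed.

Lemma mx_measurableB g h : mx_measurable g -> mx_measurable h ->
  mx_measurable (fun s => g s - h s).
Proof.
move=> mg mh i j.
rewrite (_ : (fun s => _) = (fun s => g s i j - h s i j)).
  by apply: measurable_funB; [exact: mg|exact: mh].
by apply/funext => s; rewrite !mxE.
Qed.

Lemma mx_measurable_step (phi : step R n d) : mx_measurable (step_val phi).
Proof. by move=> i j; apply: measurable_funTS; exact: measurable_step_val. Qed.

Lemma L2_distC (g h : R -> 'M[R]_(n, d)) : L2_dist g h = L2_dist h g.
Proof.
by apply: eq_integral => s _; rewrite -fnorm_sqrN opprB.
Qed.

Lemma L2_dist_ge0 (g h : R -> 'M[R]_(n, d)) : (0 <= L2_dist g h)%E.
Proof. by apply: integral_ge0 => s _; rewrite lee_fin sqr_ge0. Qed.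

(** The factors 2 are the price of working with squared distances. *)
Lemma L2_dist_triangle g h k (a b : R) :
  mx_measurable g -> mx_measurable h -> mx_measurable k ->
  (L2_dist g h <= a%:E -> L2_dist h k <= b%:E ->
   L2_dist g k <= (2 * a + 2 * b)%:E)%E.
Proof.
move=> mg mh mk gh hk.
have mfn f1 f2 : mx_measurable f1 -> mx_measurable f2 ->
    measurable_fun (`[0%R, +oo[ : set R) (fun s => fnorm (f1 s - f2 s) ^+ 2).
  by move=> m1 m2; apply: measurable_fnorm_sqr; exact: mx_measurableB.
have mfE f1 f2 : mx_measurable f1 -> mx_measurable f2 ->
    measurable_fun (`[0%R, +oo[ : set R) (fun s => (2 * fnorm (f1 s - f2 s) ^+ 2)%:E).
  by move=> m1 m2; apply/measurable_EFinP/measurable_funM => //; exact: mfn.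
have Z2 f1 f2 : mx_measurable f1 -> mx_measurable f2 ->
    (\int[lebesgue_measure]_(s in `[0%R, +oo[) (2 * fnorm (f1 s - f2 s) ^+ 2)%:E =
     2%:E * L2_dist f1 f2)%E.
  move=> m1 m2; under eq_integral do rewrite EFinM.
  rewrite ge0_integralZl_EFin//; first by move=> s _; rewrite lee_fin sqr_ge0.
  by apply/measurable_EFinP; exact: mfn.
apply: (@le_trans _ _ (\int[lebesgue_measure]_(s in `[0%R, +oo[)
   ((2 * fnorm (g s - h s) ^+ 2)%:E + (2 * fnorm (h s - k s) ^+ 2)%:E))%E).
  apply: ge0_le_integral => //.
  - by move=> s _; rewrite lee_fin sqr_ge0.
  - by apply/measurable_EFinP; exact: mfn.
  - by apply: emeasurable_funD; exact: mfE.
  - move=> s _; rewrite -EFinD lee_fin.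
    by rewrite (_ : g s - k s = (g s - h s) + (h s - k s)) ?fnorm_sqrD_le// addrA subrK.
rewrite ge0_integralD//; last 4 first.
- by move=> s _; rewrite lee_fin mulr_ge0// sqr_ge0.
- exact: mfE.
- by move=> s _; rewrite lee_fin mulr_ge0// sqr_ge0.
- exact: mfE.
rewrite Z2// Z2// (EFinD (2 * a)) (EFinM 2 a) (EFinM 2 b).
by apply: leeD; apply: lee_wpmul2l.
Qed.

Lemma wiener_step (phi : step R n d) : wiener P B (step_val phi) (step_int B phi).
Proof.
split=> [i|e e0]; first exact: (measurable_step_int hB).
exists phi; split.
  rewrite /L2_dist (_ : (fun s => _) = cst 0%E) ?integral0 ?lee_fin ?ltW//.
  by apply/funext => s; rewrite subrr fnorm_sqr0.
rewrite (_ : (fun w => _) = cst 0%E) ?integral0 ?lee_fin ?ltW//.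
by apply/funext => s; rewrite subrr fnorm_sqr0.
Qed.

Lemma chebyshev_step (phi : step R n d) (Z : T -> 'cV[R]_n) r (a e : R) :
  (forall i, measurable_fun setT (fun w => Z w i 0)) -> 0 < a ->
  (\int[P]_w (fnorm (step_int B phi w - Z w) ^+ 2)%:E <= e%:E)%E ->
  (P [set w | (a < `|step_int B phi w r 0 - Z w r 0|)%R] <= (e / a ^+ 2)%:E)%E.
Proof.
move=> mZ a0.
have mD i : measurable_fun setT (fun w => step_int B phi w i 0 - Z w i 0).
  by apply: measurable_funB => //; exact: (measurable_step_int hB).
apply: markov_le.
- exact: measurable_gt_norm.
- under eq_fun do rewrite fnorm_sqr.
  apply: measurable_sum => i; apply: measurable_sum => j.
  rewrite (ord1 j); apply: measurable_funX.
  rewrite (_ : (fun w => _) = (fun w => step_int B phi w i 0 - Z w i 0))//.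
  by apply/funext => w; rewrite !mxE.
- by move=> w; exact: sqr_ge0.
- by rewrite exprn_gt0.
- move=> w /= aw; apply: le_trans (entry_le_fnorm _ r 0); rewrite !mxE.
  by rewrite -[leRHS]real_normK ?num_real// ler_pXn2r// ?nnegrE// ltW.
Qed.

(** The Gaussian bound for step functions passes to the limit: half of the
    threshold [a] is spent on the two approximation errors, which Chebyshev's
    inequality makes arbitrarily improbable.  The constant 48 is not optimal. *)
Lemma wiener_tail g1 g2 Z1 Z2 r (a v : R) :
  mx_measurable g1 -> mx_measurable g2 ->
  wiener P B g1 Z1 -> wiener P B g2 Z2 -> 0 < a -> 0 < v ->
  (L2_dist g1 g2 <= v%:E)%E ->
  (P [set w | (a < `|Z1 w r 0 - Z2 w r 0|)%R] <=
     (2 * expR (- (a ^+ 2 / (48 * v))))%:E)%E.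
Proof.
move=> mg1 mg2 [mZ1 w1] [mZ2 w2] a0 v0 g12.
set K := 2 * expR _.
apply/lee_addgt0Pr => eps eps0.
(* [v / 3] keeps the squared distance of the two step functions below [6 * v],
   and the other bound makes the two Chebyshev terms add up to [eps]. *)
pose e := Num.min (v / 3) (eps * a ^+ 2 / 32).
have a20 : 0 < a ^+ 2 by rewrite exprn_gt0.
have e0 : 0 < e by rewrite lt_min divr_gt0//= divr_gt0// mulr_gt0.
have ev : e <= v / 3 by rewrite ge_min lexx.
have ee : e <= eps * a ^+ 2 / 32 by rewrite ge_min lexx orbT.
have [phi [p1 p2]] := w1 e e0.
have [psi [q1 q2]] := w2 e e0.
have D : (L2_dist (step_val phi) (step_val psi) <= (6 * v)%:E)%E.
  have D1 := L2_dist_triangle (mx_measurable_step phi) mg1 mg2 p1 g12.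
  have q1' : (L2_dist g2 (step_val psi) <= e%:E)%E by rewrite L2_distC.
  apply: (le_trans (L2_dist_triangle (mx_measurable_step phi) mg2
    (mx_measurable_step psi) D1 q1')).
  by rewrite lee_fin; lra.
have h0 := step_int_tail hB (a / 2) r (ltac:(by rewrite divr_ge0 ?ltW// mulr_gt0) :
  0 <= a / (12 * v)) D.
have a40 : 0 < a / 4 by rewrite divr_gt0.
have h1 := chebyshev_step r mZ1 a40 p2.
have h2 := chebyshev_step r mZ2 a40 q2.
have mU (Y : T -> R) (b : R) : measurable_fun setT Y ->
    measurable [set w | b < `|Y w| ].
  exact: measurable_gt_norm.
pose s1 := step_int B phi; pose s2 := step_int B psi.
have ms1 : measurable_fun setT (fun w => s1 w r 0) := measurable_step_int hB phi r.
have ms2 : measurable_fun setT (fun w => s2 w r 0) := measurable_step_int hB psi r.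
pose A0 := [set w | a / 2 < `|s1 w r 0 - s2 w r 0| ].
pose A1 := [set w | a / 4 < `|s1 w r 0 - Z1 w r 0| ].
pose A2 := [set w | a / 4 < `|s2 w r 0 - Z2 w r 0| ].
have mA0 : measurable A0 by apply: mU; exact: measurable_funB.
have mA1 : measurable A1 by apply: mU; exact: measurable_funB.
have mA2 : measurable A2 by apply: mU; exact: measurable_funB.
apply: (@le_trans _ _ (P (A0 `|` (A1 `|` A2)))).
  apply: le_measure; rewrite ?inE.
  - by apply: mU; exact: measurable_funB.
  - by apply: measurableU => //; exact: measurableU.
  - move=> w /= aw; apply: contrapT => /not_orP[/negP + /not_orP[/negP + /negP]].
    rewrite -!leNgt => c0 c1 c2; move: aw; rewrite ltNge => /negP; apply.
    rewrite (_ : Z1 w r 0 - Z2 w r 0 = (s1 w r 0 - s2 w r 0) +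
      (- (s1 w r 0 - Z1 w r 0) + (s2 w r 0 - Z2 w r 0))); last by ring.
    rewrite (le_trans (ler_normD _ _))// (le_trans (lerD c0 (ler_normD _ _)))//.
    by rewrite normrN; lra.
apply: le_trans (measureU2 _ mA0 (measurableU _ _ mA1 mA2)) _.
apply: leeD.
  apply: le_trans h0 _; rewrite lee_fin /K ler_pM2l// ler_expR.
  by rewrite le_eqVlt; apply/orP; left; apply/eqP; field; rewrite gt_eqF.
apply: le_trans (measureU2 _ mA1 mA2) _.
apply: le_trans (leeD h1 h2) _.
rewrite -EFinD lee_fin -mulrDl ler_pdivrMr ?exprn_gt0//.
have -> : (a / 4) ^+ 2 = a ^+ 2 / 16 by field.
lra.
Qed.

Lemma wiener_tail_le (g1 g2 : R -> 'M[R]_(n, d)) (Z1 Z2 : T -> 'cV[R]_n) r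
    (a v k : R) :
  mx_measurable g1 -> mx_measurable g2 ->
  wiener P B g1 Z1 -> wiener P B g2 Z2 -> 0 < a -> 0 < v ->
  (L2_dist g1 g2 <= v%:E)%E -> 48 * v * k <= a ^+ 2 ->
  (P [set w | (a < `|Z1 w r 0 - Z2 w r 0|)%R] <= (2 * expR (- k))%:E)%E.
Proof.
move=> m1 m2 w1 w2 a0 v0 g12 hk.
apply: le_trans (wiener_tail r m1 m2 w1 w2 a0 v0 g12) _.
rewrite lee_fin ler_pM2l// ler_expR lerN2 ler_pdivlMr ?mulr_gt0//.
by rewrite mulrC.
Qed.

End wiener_tail.

(** * Mean-square regularity of the kernel *)

Section riemann_sums.
Context (R : realType).

(** Heine's theorem, the radius being the parameter of a near covering. *)
Lemma uniform_continuity_itv (a b : R) (f : R -> R) : {within `[a, b], continuous f} ->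
  forall e, 0 < e -> exists2 del, 0 < del &
    forall x y, x \in `[a, b] -> y \in `[a, b] -> `|x - y| < del ->
      `|f x - f y| < e.
Proof.
move=> /subspace_continuousP cf e e0.
have /compact_near_coveringP cov : compact (`[a, b] : set R) by exact: segment_compact.
have e20 : 0 < e / 2 by rewrite divr_gt0.
pose Q (del x : R) := x \in `[a, b] -> forall y, y \in `[a, b] ->
  `|x - y| < del -> `|f x - f y| < e.
have : \forall del \near 0^'+, `[a, b]%classic `<=` Q del.
  apply: cov => x xab.
  have /cvgrPdist_lt/(_ _ e20) := cf x xab.
  rewrite near_withinE => /nbhs_ballP[eta /= eta0 heta].
  have near_f y : y \in `[a, b] -> `|x - y| < eta -> `|f x - f y| < e / 2.
    by move=> yab xy; apply: heta.
  have eta20 : 0 < eta / 2 by rewrite divr_gt0.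
  exists (ball x (eta / 2), [set del | del < eta / 2]) => /=.
    split; first exact: nbhsx_ballx.
    exact: nbhs_right_lt.
  move=> [x' del] [/= xx' deleta] x'ab y yab x'y.
  rewrite (_ : f x' - f y = (f x - f y) - (f x - f x')); last by ring.
  rewrite (le_lt_trans (ler_normB _ _))// [ltRHS](splitr e).
  apply: ltrD; apply: near_f => //.
    rewrite (_ : x - y = (x - x') + (x' - y)); last by ring.
    rewrite (le_lt_trans (ler_normD _ _))// [ltRHS](splitr eta).
    by apply: ltrD => //; exact: lt_trans deleta.
  by rewrite (lt_trans xx')// [ltRHS](splitr eta) ltrDl.
move=> H; have [del [del0 hdel]] : exists del : R, 0 < del /\ `[a, b]%classic `<=` Q del.
  apply: (@filter_ex _ (nbhs (0 : R)^'+)).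
  exact: filterI (nbhs_right_gt (0 : R)) H.
by exists del => // x y xab; apply: hdel.
Qed.

(** Right-endpoint sums for the derivative over the segment from [a] to [t],
    written on a uniform grid of the larger segment from [s] to [t] so that the
    sample times do not depend on [a].  Clipping the grid at [a] keeps every term
    comparable, by the mean value theorem, with an increment of [F]. *)
Lemma riemann_sum_derivative (F phi : R -> R) (s a t : R) :
  s <= a -> a <= t -> {within `[a, t], continuous F} ->
  {within `[a, t], continuous phi} ->
  (forall x, x \in `]a, t[ -> is_derive x 1 F (phi x)) ->
  let tau N i := s + (t - s) / N.+1%:R * i%:R in
  \sum_(i < N.+1) (Num.max a (tau N i.+1) - Num.max a (tau N i)) * phi (tau N i.+1)
    @[N --> \oo] --> F t - F a.
Proof.
move=> sa at_ cF cphi dF tau.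
have tau0 N : tau N 0%N = s by rewrite /tau mulr0 addr0.
have tauN N : tau N N.+1 = t by rewrite /tau mulfVK ?pnatr_eq0// addrC subrK.
have tauS N i : tau N i.+1 = tau N i + (t - s) / N.+1%:R.
  by rewrite /tau -[i.+1%:R]natr1 mulrDr mulr1 addrA.
have ts0 : 0 <= t - s by rewrite subr_ge0 (le_trans sa).
have tau_nd N i : tau N i <= tau N i.+1 by rewrite tauS lerDl divr_ge0.
have tau_le N i : (i <= N.+1)%N -> tau N i <= t.
  by move=> iN; rewrite -(tauN N) lerD2l ler_wpM2l ?divr_ge0// ler_nat.
apply/cvgrPdist_le => e e0.
pose e' := e / (t - a + 1).
have ta1 : 0 < t - a + 1 by rewrite ltr_wpDl ?subr_ge0.
have e'0 : 0 < e' by rewrite divr_gt0.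
have [del del0 hdel] := uniform_continuity_itv cphi e'0.
have hlim : (t - s) / N.+1%:R @[N --> \oo] --> (0 : R).
  by rewrite -(mulr0 (t - s)); apply: cvgMr; exact: cvg_harmonic.
have /cvgrPdist_lt/(_ _ del0) := hlim.
apply: filterS => N; rewrite sub0r normrN ger0_norm ?divr_ge0// => hN.
pose c i := Num.max a (tau N i).
have cS i : c i <= c i.+1 by rewrite /c ge_max le_max lexx/= le_max tau_nd orbT.
have ca i : a <= c i by rewrite /c le_max lexx.
have ct i : (i <= N.+1)%N -> c i <= t by move=> iN; rewrite ge_max at_ tau_le.
have -> : F t - F a = \sum_(i < N.+1) (F (c i.+1) - F (c i)).
  have := telescope_sumr (fun i => F (c i)) (leq0n N.+1).
  by rewrite big_mkord => ->; rewrite /c tau0 tauN (max_idPr at_) (max_idPl sa).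
rewrite -sumrB (le_trans (ler_norm_sum _ _ _))//.
apply: (@le_trans _ _ (\sum_(i < N.+1) (c i.+1 - c i) * e')); last first.
  rewrite -mulr_suml; have := telescope_sumr c (leq0n N.+1).
  rewrite big_mkord => ->; rewrite /c tau0 tauN (max_idPr at_) (max_idPl sa).
  by rewrite /e' mulrCA ler_piMr ?(ltW e0)// ler_pdivrMr// mul1r lerDl.
apply: ler_sum => i _.
have [cc|cc] := leP (c i.+1) (c i).
  have -> : c i.+1 = c i by apply/le_anti; rewrite cc cS.
  by rewrite -/(c i.+1) -/(c i) (_ : c i.+1 = c i) ?subrr ?mul0r ?subrr ?normr0//;
    apply/le_anti; rewrite cc cS.
have cE : c i.+1 = tau N i.+1.
  by rewrite /c; case: leP => // h; move: cc; rewrite ltNge {1}/c (max_idPl (ltW h)) ca.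
have iN : (i < N.+1)%N by exact: ltn_ord.
have dFi x : x \in `]c i, c i.+1[ -> is_derive x 1 F (phi x).
  rewrite in_itv/= => /andP[x1 x2]; apply: dF.
  by rewrite in_itv/= (le_lt_trans (ca i) x1) (lt_le_trans x2 (ct _ iN)).
have cFi : {within `[c i, c i.+1], continuous F}.
  apply: continuous_subspaceW cF => x /=; rewrite !in_itv/= => /andP[x1 x2].
  by rewrite (le_trans (ca i) x1) (le_trans x2 (ct _ iN)).
have [xi xii Fxi] := MVT cc dFi cFi.
rewrite Fxi -/(c i.+1) -/(c i) mulrC -mulrBr normrM ger0_norm ?subr_ge0//.
apply: ler_wpM2l; first by rewrite subr_ge0.
apply/ltW; rewrite -cE; move: xii; rewrite in_itv/= => /andP[x1 x2].
apply: hdel.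
- by rewrite in_itv/= (le_trans (ca i) (ltW x1)) (le_trans (ltW x2) (ct _ iN)).
- by rewrite in_itv/= ca ct.
- rewrite distrC ger0_norm ?subr_ge0 1?ltW//; apply: le_lt_trans hN.
  rewrite lerBlDr cE tauS [leRHS]addrC lerD2r (le_trans _ (ltW x1))// /c le_max lexx orbT//.
Qed.

End riemann_sums.

Section kernel_slices.
Context (R : realType) (n m : nat).

Lemma within_continuous_entry (X : topologicalType) (A : set X)
    (f : X -> 'M[R]_(n, m)) i j :
  {within A, continuous f} -> {within A, continuous (fun x => f x i j)}.
Proof.
move=> cf; apply: (@within_continuous_comp _ _ _ A f (fun M : 'M[R]_(n, m) => M i j)) => //.
by move=> M _; exact: coord_continuous.
Qed.

Lemma within_continuous_precomp (X Y Z : topologicalType) (A : set X) (D : set Y)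
    (g : X -> Y) (f : Y -> Z) :
  continuous g -> (forall x, A x -> D (g x)) ->
  {within D, continuous f} -> {within A, continuous (f \o g)}.
Proof.
move=> cg AD /subspace_continuousP cf; apply/subspace_continuousP => x Ax.
apply: cvg_comp (cf _ (AD _ Ax)) => U; rewrite /within/= => /cg gU.
change (\forall y \near nbhs x, A y -> U (g y)).
have {}gU : \forall y \near nbhs x, D (g y) -> U (g y) := gU.
by apply: (filterS _ gU) => y Uy Ay; apply: Uy; exact: AD.
Qed.

Variables (H H1 : R -> R -> 'M[R]_(n, m)).

Lemma slice_fst (K : R -> R -> 'M[R]_(n, m)) (u t : R) i j :
  {within Delta, continuous (fun p : R * R => K p.1 p.2)} -> 0 <= u ->
  {within `[u, t], continuous (fun v => K v u i j)}.
Proof.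
move=> cK u0; apply: (@within_continuous_precomp _ _ _ _ Delta (fun v => (v, u))
    (fun p => K p.1 p.2 i j)) => //.
- by move=> v; exact: (cvg_pair (@cvg_id _ (nbhs v)) (cvg_cst u)).
- by move=> v /=; rewrite in_itv/= /Delta/= => /andP[uv _]; rewrite u0 uv.
- exact: within_continuous_entry.
Qed.

Lemma slice_snd (K : R -> R -> 'M[R]_(n, m)) (t : R) i j :
  {within Delta, continuous (fun p : R * R => K p.1 p.2)} ->
  {within `[0, t], continuous (fun u => K t u i j)}.
Proof.
move=> cK; apply: (@within_continuous_precomp _ _ _ _ Delta (fun u => (t, u))
    (fun p => K p.1 p.2 i j)) => //.
- by move=> v; exact: (cvg_pair (cvg_cst t) (@cvg_id _ (nbhs v))).
- exact: within_continuous_entry.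
Qed.

(** Near a point [v] larger than [u], staying above [u] is no constraint, so the
    difference quotients of [C10] are two-sided. *)
Lemma is_derive_slice (u v : R) i j : C10 H H1 -> 0 <= u -> u < v ->
  is_derive v 1 (fun x => H x u i j) (H1 v u i j).
Proof.
move=> [_ _ dH] u0 uv.
have Duv : Delta (v, u) by rewrite /Delta/= u0 ltW.
have := dH v u Duv => {}dH.
have q : h^-1 *: (H (h *: 1 + v) u i j - H v u i j) @[h --> 0^'] --> H1 v u i j.
  have dHij : ((w - v)^-1 *: (H w u - H v u)) i j
      @[w --> within [set w | u <= w] v^'] --> H1 v u i j.
    exact: (@cvg_comp _ _ _ _ (fun M : 'M[R]_(n, m) => M i j) _ _ _ dH
      (@coord_continuous R n m i j (H1 v u))).
  apply/cvgrPdist_lt => e e0.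
  move/cvgrPdist_lt : dHij => /(_ e e0).
  rewrite near_withinE near_withinE => /nbhs_ballP[r /= r0 hr].
  apply/nbhs_ballP; exists (Num.min r (v - u)) => /=.
    by rewrite lt_min r0 subr_gt0.
  rewrite -ball_normE/= in hr *; move=> h /=; rewrite sub0r normrN lt_min => /andP[hr' huv] h0.
  have := hr (h + v); rewrite /= opprD addrCA subrr addr0 normrN => /(_ hr').
  rewrite !mxE addrK [h *: 1]mulr1; apply.
    by rewrite -[X in _ != X]add0r (inj_eq (addIr v)).
  rewrite -lerBlDr; move: huv; rewrite ltr_norml => /andP[huv _].
  by apply: ltW; rewrite -opprB.
by apply: DeriveDef; [exact: cvgP q|exact: cvg_lim q].
Qed.

End kernel_slices.

Section kernel_regularity.
Context (R : realType).

Lemma cvg_finsum (I : Type) (r : seq I) (f : I -> nat -> R) (l : I -> R) :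
  (forall i, f i N @[N --> \oo] --> l i) ->
  (\sum_(i <- r) f i N) @[N --> \oo] --> \sum_(i <- r) l i.
Proof.
move=> fl; elim: r => [|i r IH].
  by rewrite big_nil; under eq_fun do rewrite big_nil; exact: cvg_cst.
by rewrite big_cons; under eq_fun do rewrite big_cons; exact: cvgD.
Qed.

Lemma limn_einf_le (u : nat -> \bar R) (b : \bar R) :
  (forall k, u k <= b)%E -> (limn_einf u <= b)%E.
Proof.
move=> ub; rewrite limn_einf_lim; apply: lime_le; first exact: is_cvg_einfs.
apply: nearW => k; apply: le_trans (ub k); apply: ereal_inf_lbound.
by exists k => /=.
Qed.

Lemma fnorm_sqrZ (m n : nat) (a : R) (A : 'M[R]_(m, n)) :
  fnorm (a *: A) ^+ 2 = a ^+ 2 * fnorm A ^+ 2.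
Proof.
rewrite !fnorm_sqr mulr_sumr; apply: eq_bigr => i _; rewrite mulr_sumr.
by apply: eq_bigr => j _; rewrite mxE exprMn.
Qed.

Lemma fnorm_sqr_sum_le (m n N : nat) (A : 'I_N -> 'M[R]_(m, n)) :
  fnorm (\sum_i A i) ^+ 2 <= N%:R * \sum_i fnorm (A i) ^+ 2.
Proof.
rewrite fnorm_sqr; under [X in _ <= _ * X]eq_bigr do rewrite fnorm_sqr.
rewrite [X in _ * X]exchange_big/= mulr_sumr; apply: ler_sum => i _.
rewrite [X in _ * X]exchange_big/= mulr_sumr; apply: ler_sum => j _ /=.
rewrite summxE; have := sqr_sum_mul_le (fun k => A k i j) (fun=> 1).
rewrite /= (eq_bigr (fun k => A k i j)) => [|k _]; last by rewrite mulr1.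
by rewrite expr1n sumr_const card_ord mulrC.
Qed.

Lemma measurable_cut (n d : nat) (t : R) (g : R -> 'M[R]_(n, d)) :
  (forall i j, {within `[0, t], continuous (fun s => g s i j)}) ->
  forall i j, measurable_fun setT (fun s => cut `[0, t] g s i j).
Proof.
move=> cg i j.
have mg : measurable_fun (`[0, t]%classic : set R) (fun s => g s i j).
  by apply: subspace_continuous_measurable_fun => //; exact: cg.
move/(measurable_restrictT _ _).1 : mg => /(_ (measurable_itv _)).
congr measurable_fun; apply/funext => s; rewrite /cut patchE.
by case: ifP => //; rewrite mxE.
Qed.

Lemma integral_cut_sub (n d : nat) (D E : set R) (g : R -> 'M[R]_(n, d)) :
  D `<=` E ->
  (\int[lebesgue_measure]_(s in E) (fnorm (cut D g s) ^+ 2)%:E =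
   \int[lebesgue_measure]_(s in D) (fnorm (g s) ^+ 2)%:E)%E.
Proof.
move=> DE; rewrite integral_mkcond [RHS]integral_mkcond; apply: eq_integral => s _.
rewrite !patchE /cut; have [sD|sD] := boolP (s \in D).
  by rewrite (mem_set (DE _ (set_mem sD))).
by case: ifP => // _; rewrite fnorm_sqr0.
Qed.

Context (n : nat) (H H1 : R -> R -> 'M[R]_n).
Hypothesis hH : C10 H H1.

(** Minkowski's integral inequality for the increments of [H] in its first argument, in
    the form obtained from Riemann sums of [H1] and Fatou's lemma.  Replacing [s] by
    [max s u] covers at once the region [u <= s] and the triangle [s <= u <= t]. *)
Lemma kernel_increment_L2 (s t K : R) : 0 <= s -> s <= t ->
  (forall tau, s <= tau <= t ->
     (\int[lebesgue_measure]_(u in `[0%R, tau]) (fnorm (H1 tau u) ^+ 2)%:E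
       <= K%:E)%E) ->
  (\int[lebesgue_measure]_(u in `[0%R, t])
      (fnorm (H t u - H (Num.max s u) u) ^+ 2)%:E <= ((t - s) ^+ 2 * K)%:E)%E.
Proof.
move=> s0 st hK; have [cH cH1 dH] := hH.
pose h (N : nat) := (t - s) / N.+1%:R.
have h0 N : 0 <= h N by rewrite divr_ge0// subr_ge0.
pose tau N i := s + h N * i%:R.
have tauS N i : tau N i.+1 = tau N i + h N.
  by rewrite /tau -[i.+1%:R]natr1 mulrDr mulr1 addrA.
have tauN N : tau N N.+1 = t by rewrite /tau mulfVK ?pnatr_eq0// addrC subrK.
have tau_ge N i : s <= tau N i by rewrite lerDl mulr_ge0.
have tau_le N i : (i <= N.+1)%N -> tau N i <= t.
  by move=> iN; rewrite -(tauN N) lerD2l ler_wpM2l// ler_nat.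
pose a u := Num.max s u.
pose w N i u := Num.max (a u) (tau N i.+1) - Num.max (a u) (tau N i).
(* The sections are extended by 0 beyond the sample time, where their weight
   vanishes, to be measurable on the whole line. *)
pose G N i := cut `[0, tau N i.+1] (H1 (tau N i.+1)).
pose Rs N u := \sum_(i < N.+1) w N i u *: G N i u.
have mG N i k l : measurable_fun setT (fun u => G N i u k l).
  by apply: measurable_cut => k' l'; exact: slice_snd.
have mw N i : measurable_fun setT (w N i).
  by apply: measurable_funB; apply: measurable_maxr => //; exact: measurable_maxr.
have mR N (D : set R) : measurable_fun D (fun u => fnorm (Rs N u) ^+ 2).
  apply: measurable_fnorm_sqr => k l; apply: measurable_funTS.
  rewrite (_ : (fun u => _) = (fun u => \sum_(i < N.+1) w N i u * G N i u k l)).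
    by apply: measurable_sum => i; exact: measurable_funM.
  by apply/funext => u; rewrite summxE; apply: eq_bigr => i _; rewrite mxE.
have w_le N i u : 0 <= w N i u <= h N.
  rewrite /w tauS subr_ge0 lerBlDl; have := h0 N.
  by case: (leP (a u) (tau N i)); case: (leP (a u) (tau N i + h N)); lra.
have bound N : (\int[lebesgue_measure]_(u in `[0%R, t]) (fnorm (Rs N u) ^+ 2)%:E
    <= ((t - s) ^+ 2 * K)%:E)%E.
  pose c := N.+1%:R * h N ^+ 2.
  have c0 : 0 <= c by rewrite mulr_ge0// exprn_ge0.
  have mGE (D : set R) i : measurable_fun D (fun u => (fnorm (G N i u) ^+ 2)%:E).
    apply/measurable_EFinP; apply: measurable_fnorm_sqr => k l.
    exact: measurable_funTS.
  apply: (@le_trans _ _ (\int[lebesgue_measure]_(u in `[0%R, t])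
      (c%:E * \sum_(i < N.+1) (fnorm (G N i u) ^+ 2)%:E))%E).
    apply: ge0_le_integral => //.
    - by move=> u _; rewrite lee_fin sqr_ge0.
    - by apply/measurable_EFinP; exact: mR.
    - by apply: measurable_funeM; apply: emeasurable_sum => i; exact: mGE.
    - move=> u _; rewrite sumEFin -EFinM lee_fin.
      apply: le_trans (fnorm_sqr_sum_le _) _.
      rewrite -mulrA ler_wpM2l// mulr_sumr; apply: ler_sum => i _.
      rewrite fnorm_sqrZ ler_wpM2r ?sqr_ge0//.
      have /andP[w1 w2] := w_le N i u.
      by rewrite ler_pXn2r// nnegrE.
  rewrite ge0_integralZl_EFin//; last 2 first.
  - by move=> u _; apply: sume_ge0 => i _; rewrite lee_fin sqr_ge0.
  - by apply: emeasurable_sum => i; exact: mGE.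
  rewrite ge0_integral_sum//; last 2 first.
  - by move=> i; exact: mGE.
  - by move=> i u _; rewrite lee_fin sqr_ge0.
  apply: (@le_trans _ _ (c%:E * \sum_(i < N.+1) K%:E)%E).
    apply: lee_wpmul2l; first by rewrite lee_fin.
    apply: lee_sum => i _; rewrite integral_cut_sub.
      by apply: hK; rewrite tau_ge tau_le.
    move=> u /=; rewrite !in_itv/= => /andP[-> /le_trans]; apply.
    exact: tau_le.
  rewrite sumEFin -EFinM lee_fin sumr_const card_ord /c /h -[K *+ _]mulr_natr.
  rewrite le_eqVlt; apply/orP; left; apply/eqP; field.
  by rewrite addrC natr1 pnatr_eq0.
have cvgR u : u \in `[0, t] ->
    (fnorm (Rs N u) ^+ 2)%:E @[N --> \oo] -->
    (fnorm (H t u - H (Num.max s u) u) ^+ 2)%:E.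
  rewrite in_itv/= => /andP[u0 ut].
  have at_ : a u <= t by rewrite /a ge_max st ut.
  have sa : s <= a u by rewrite /a le_max lexx.
  have ua : u <= a u by rewrite /a le_max lexx orbT.
  have entry k l : Rs N u k l @[N --> \oo] --> (H t u - H (a u) u) k l.
    have sub : `[a u, t] `<=` `[u, t].
      by move=> x /=; rewrite !in_itv/= => /andP[/(le_trans ua) -> ->].
    have cF := continuous_subspaceW sub (@slice_fst _ _ _ H u t k l cH u0).
    have cF1 := continuous_subspaceW sub (@slice_fst _ _ _ H1 u t k l cH1 u0).
    have dF x : x \in `]a u, t[ -> is_derive x 1 (fun v => H v u k l) (H1 x u k l).
      rewrite in_itv/= => /andP[/(le_lt_trans ua) ux _].
      exact: is_derive_slice.
    have E N : Rs N u k l = \sum_(i < N.+1)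
        (Num.max (a u) (tau N i.+1) - Num.max (a u) (tau N i)) *
          H1 (tau N i.+1) u k l.
      rewrite /Rs summxE; apply: eq_bigr => i _.
      rewrite mxE -/(w N i u) /G /cut.
      have [//|/negP uN] := boolP (u \in _).
      have tu : tau N i.+1 <= u.
        rewrite leNgt; apply/negP => ut'; apply: uN.
        by rewrite mem_setE in_itv/= u0 ltW.
      have ta := le_trans tu ua.
      have ta' : tau N i <= a u by apply: le_trans ta; rewrite tauS lerDl.
      by rewrite /w (max_idPl ta) (max_idPl ta') subrr !mul0r.
    rewrite !mxE; under eq_fun do rewrite E.
    exact: (riemann_sum_derivative sa at_ cF cF1 dF).
  rewrite fnorm_sqr; under eq_fun do rewrite fnorm_sqr.
  apply: cvg_EFin; first exact: nearW.
  apply: cvg_finsum => k; apply: cvg_finsum => l.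
  by apply: cvgM; exact: entry.
apply: (@le_trans _ _ (\int[lebesgue_measure]_(u in `[0%R, t])
    limn_einf (fun N => (fnorm (Rs N u) ^+ 2)%:E))%E).
  rewrite le_eqVlt; apply/orP; left; apply/eqP; apply: eq_integral => u ut.
  by rewrite (cvg_limn_einf_sup (cvgR u _)).1//; exact: set_mem.
apply: le_trans (fatou _ _ _ _) _ => //.
- by move=> N; apply/measurable_EFinP; exact: mR.
- by move=> N u _; rewrite lee_fin sqr_ge0.
- exact: limn_einf_le.
Qed.

End kernel_regularity.

Lemma measurable_fun_half_line (R : realType) (D : set R) (g : R -> R) :
  D `<=` `[0, +oo[ -> {within `[0, +oo[, continuous g} -> measurable_fun D g.
Proof.
move=> D0 cg; suff : measurable_fun (`[0, +oo[%classic : set R) g.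
  by apply: measurable_funS.
by apply: subspace_continuous_measurable_fun.
Qed.

Section integrands.
Context (R : realType) (n d : nat).
Variables (H H1 : R -> R -> 'M[R]_n) (f : R -> 'M[R]_(n, d)).
Hypothesis hH : C10 H H1.
Hypothesis f_cont : {within `[0, +oo[, continuous f}.
Variable M2 : R.
Hypothesis f_bd : forall t, 0 <= t -> fnorm (f t) ^+ 2 <= M2.

Let sub0y (t : R) : `[0, t] `<=` `[0, +oo[.
Proof. by move=> x /=; rewrite !in_itv/= => /andP[-> _]. Qed.

Lemma M2_ge0 : 0 <= M2.
Proof. exact: le_trans (sqr_ge0 _) (f_bd (lexx 0)). Qed.

Lemma measurable_mulmx (D : set R) (K : R -> 'M[R]_n) i j :
  measurable D -> D `<=` `[0, +oo[ ->
  (forall k, measurable_fun D (fun s => K s i k)) ->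
  measurable_fun D (fun s => (K s *m f s) i j).
Proof.
move=> mD D0 mK; under eq_fun do rewrite mxE.
apply: measurable_sum => k; apply: measurable_funM => //.
by apply: measurable_fun_half_line => //; exact: within_continuous_entry.
Qed.

Lemma mx_measurable_cut (D : set R) (g : R -> 'M[R]_(n, d)) :
  measurable D -> (forall i j, measurable_fun D (fun s => g s i j)) ->
  mx_measurable (cut D g).
Proof.
move=> mD mg i j; apply: measurable_funTS.
move/(measurable_restrictT _ mD).1 : (mg i j).
congr measurable_fun; apply/funext => s; rewrite /cut patchE.
by case: ifP => //; rewrite mxE.
Qed.

Definition integrand (t : R) := cut `[0, t] (fun s => H t s *m f s).

Lemma mx_measurable_integrand t : mx_measurable (integrand t).
Proof.
apply: mx_measurable_cut => // i j; apply: measurable_mulmx => //.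
move=> k; apply: subspace_continuous_measurable_fun => //.
by apply: slice_snd; case: hH.
Qed.

Lemma fnorm_sqr_mulf_le (A : 'M[R]_n) u : 0 <= u ->
  fnorm (A *m f u) ^+ 2 <= M2 * fnorm A ^+ 2.
Proof.
move=> u0; apply: le_trans (fnorm_sqrM_le _ _) _.
by rewrite mulrC ler_wpM2r ?sqr_ge0// f_bd.
Qed.

(** The increment is that of [kernel_increment_L2] multiplied by [f], of squared
    norm of order [(t - s) ^ 2], plus the diagonal of [H] multiplied by [f] on
    the new piece from [s] to [t], of order [t - s]. *)
Lemma integrand_increment (s t K : R) : 0 <= s -> s <= t ->
  (forall tau, s <= tau <= t ->
     (\int[lebesgue_measure]_(u in `[0%R, tau]) (fnorm (H1 tau u) ^+ 2)%:E
       <= K%:E)%E) ->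
  (forall u, 0 <= u <= t -> fnorm (H u u) ^+ 2 <= K) ->
  (L2_dist (integrand t) (integrand s) <=
     (2 * M2 * K * ((t - s) ^+ 2 + (t - s)))%:E)%E.
Proof.
move=> s0 st hK hD; have [cH _ _] := hH.
have t0 := le_trans s0 st.
have K0 : 0 <= K by apply: le_trans (hD 0 _); rewrite ?sqr_ge0// lexx.
have cmax : continuous (fun u : R => Num.max s u).
  have -> : (fun u : R => Num.max s u) = (fun u => (s + u + `|s - u|) / 2).
    by apply/funext => v; rewrite maxr_absE.
  move=> u; apply: cvgMl; apply: cvgD; first by apply: cvgD; [exact: cvg_cst|exact: cvg_id].
  by apply: cvg_norm; apply: cvgB; [exact: cvg_cst|exact: cvg_id].
pose E u := fnorm (H t u - H (Num.max s u) u) ^+ 2.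
have mE : measurable_fun (`[0, t]%classic : set R) E.
  apply: measurable_fnorm_sqr => i j.
  rewrite (_ : (fun u => _) = (fun u => H t u i j - H (Num.max s u) u i j)); last first.
    by apply/funext => u; rewrite !mxE.
  apply: measurable_funB.
    by apply: subspace_continuous_measurable_fun => //; exact: slice_snd.
  apply: subspace_continuous_measurable_fun => //.
  apply: (@within_continuous_precomp _ _ _ _ Delta (fun u => (Num.max s u, u))
    (fun p => H p.1 p.2 i j)).
  - by move=> u; exact: (cvg_pair (cmax u) (@cvg_id _ (nbhs u))).
  - by move=> u; rewrite /Delta/= in_itv/= => /andP[-> _]; rewrite le_max lexx orbT.
  - exact: within_continuous_entry.
pose c := 2 * M2.
have c0 : 0 <= c by rewrite mulr_ge0// M2_ge0.
pose g u := integrand t u - integrand s u.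
have -> : L2_dist (integrand t) (integrand s) =
    (\int[lebesgue_measure]_(u in `[0%R, t]) (fnorm (g u) ^+ 2)%:E)%E.
  rewrite -(integral_cut_sub g (@sub0y t)); apply: eq_integral => u /set_mem/=.
  rewrite in_itv/= andbT => u0; rewrite /cut; case: ifPn => // /negP ut.
  rewrite /integrand /cut; rewrite !ifN ?subrr//.
    apply/negP => /set_mem/=; rewrite in_itv/= => /andP[_ us]; apply: ut.
    by rewrite mem_setE in_itv/= u0 (le_trans us).
  exact/negP.
pose J : set R := `]s, t]%classic.
have mJ : measurable J by exact: measurable_itv.
have mJ1 : measurable_fun (`[0, t]%classic : set R) (\1_J : R -> R) by exact: measurable_indic.
apply: (@le_trans _ _ (\int[lebesgue_measure]_(u in `[0%R, t])
   (c%:E * (E u)%:E + (c * K)%:E * (\1_J u)%:E))%E).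
  apply: ge0_le_integral => //.
  - by move=> u _; rewrite lee_fin sqr_ge0.
  - apply/measurable_EFinP; apply: (measurable_funS _ (@sub0y t)) => //.
    by apply: measurable_fnorm_sqr; apply: mx_measurableB; exact: mx_measurable_integrand.
  - apply: emeasurable_funD; apply: measurable_funeM; apply/measurable_EFinP => //.
  - move=> u /=; rewrite in_itv/= => /andP[u0 ut]; rewrite -!EFinM -EFinD lee_fin.
    have uT : u \in `[0, t]%classic by rewrite mem_setE in_itv/= u0.
    have gE : g u = (H t u - H (Num.max s u) u) *m f u +
        (if s < u then H u u *m f u else 0).
      rewrite /g /integrand /cut uT mulmxBl.
      have [us|su] := leP u s.
        by rewrite mem_setE in_itv/= u0 us addr0.
      by rewrite mem_setE in_itv/= u0 leNgt su/= subr0 subrK.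
    rewrite gE (le_trans (fnorm_sqrD_le _ _))// /c -!mulrA -!mulrDr ler_pM2l//.
    rewrite mulrDr lerD//; first exact: fnorm_sqr_mulf_le.
    rewrite indicE /J mem_setE in_itv/= ut andbT.
    case: ifP => su; rewrite ?fnorm_sqr0 ?mulr0// mulr1.
    apply: le_trans (fnorm_sqr_mulf_le _ u0) _.
    by rewrite ler_wpM2l ?M2_ge0// hD// u0 ut.
rewrite ge0_integralD//; last 4 first.
- by move=> u _; rewrite -EFinM lee_fin mulr_ge0// sqr_ge0.
- by apply: measurable_funeM; exact/measurable_EFinP.
- by move=> u _; rewrite mule_ge0 ?lee_fin ?(mulr_ge0 c0 K0).
- by apply: measurable_funeM; exact/measurable_EFinP.
rewrite ge0_integralZl_EFin//; last 2 first.
- by move=> u _; rewrite lee_fin sqr_ge0.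
- exact/measurable_EFinP.
rewrite ge0_integralZl_EFin//; last 2 first.
- exact/measurable_EFinP.
- exact: mulr_ge0.
rewrite mulrDr (EFinD (2 * M2 * K * (t - s) ^+ 2)); apply: leeD.
  rewrite (_ : 2 * M2 * K * (t - s) ^+ 2 = c * ((t - s) ^+ 2 * K)); last by rewrite /c; ring.
  rewrite (EFinM c); apply: lee_wpmul2l; first by rewrite lee_fin.
  exact: (kernel_increment_L2 hH).
rewrite (EFinM (2 * M2 * K)); apply: lee_wpmul2l; first by rewrite lee_fin mulr_ge0.
rewrite integral_indic//; apply: (@le_trans _ _ (lebesgue_measure J)).
  by apply: le_measure; rewrite ?inE//; exact: measurableI.
rewrite lebesgue_measure_itv/= lte_fin; case: ltP => // _.
by rewrite lee_fin subr_ge0.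
Qed.

Lemma integrand_limit_dist (Hinf : R -> 'M[R]_n) (t v : R) :
  {within `[0, +oo[, continuous Hinf} ->
  (\int[lebesgue_measure]_(s in `[0%R, t]) (fnorm (H t s - Hinf s) ^+ 2)%:E
     <= v%:E)%E ->
  (L2_dist (integrand t) (cut `[0%R, t] (fun s => (Hinf s *m f s)%R)) <= (M2 * v)%:E)%E.
Proof.
move=> cHinf hv; have [cH _ _] := hH.
pose g s := (H t s - Hinf s) *m f s.
have -> : L2_dist (integrand t) (cut `[0, t] (fun s => Hinf s *m f s)) =
    (\int[lebesgue_measure]_(s in `[0%R, t]) (fnorm (g s) ^+ 2)%:E)%E.
  rewrite -(integral_cut_sub g (@sub0y t)); apply: eq_integral => u _.
  rewrite /integrand /cut; case: ifP => _; last by rewrite subrr.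
  by rewrite /g mulmxBl.
have mD i j : measurable_fun (`[0, t]%classic : set R) (fun s => (H t s - Hinf s) i j).
  rewrite (_ : (fun s => _) = (fun s => H t s i j - Hinf s i j)); last first.
    by apply/funext => u; rewrite !mxE.
  apply: measurable_funB.
    by apply: subspace_continuous_measurable_fun => //; exact: slice_snd.
  by apply: measurable_fun_half_line => //; exact: within_continuous_entry.
rewrite EFinM; apply: (@le_trans _ _ (M2%:E * \int[lebesgue_measure]_(s in `[0%R, t])
    (fnorm (H t s - Hinf s) ^+ 2)%:E)%E); last first.
  by apply: lee_wpmul2l => //; rewrite lee_fin M2_ge0.
rewrite -ge0_integralZl_EFin ?M2_ge0//; last 2 first.
- by move=> s _; rewrite lee_fin sqr_ge0.
- by apply/measurable_EFinP; exact: measurable_fnorm_sqr.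
apply: ge0_le_integral => //.
- by move=> s _; rewrite lee_fin sqr_ge0.
- apply/measurable_EFinP; apply: measurable_fnorm_sqr => i j.
  exact: measurable_mulmx.
- by apply: measurable_funeM; apply/measurable_EFinP; exact: measurable_fnorm_sqr.
- move=> s /=; rewrite in_itv/= => /andP[s0 _]; rewrite -EFinM lee_fin.
  exact: fnorm_sqr_mulf_le.
Qed.

End integrands.

(** * Truncation in time *)

Section truncation.
Context (R : realType) (n d : nat).
Implicit Type g : R -> 'M[R]_(n, d).

(** Pythagoras: the two pieces have disjoint supports. *)
Lemma L2_dist_cut g (D E : set R) :
  measurable D -> measurable E -> D `<=` E -> E `<=` `[0, +oo[ ->
  mx_measurable g ->
  (L2_dist (cut E g) (cut D g) +
   \int[lebesgue_measure]_(s in D) (fnorm (g s) ^+ 2)%:E =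
   \int[lebesgue_measure]_(s in E) (fnorm (g s) ^+ 2)%:E)%E.
Proof.
move=> mD mE DE E0 mg.
have -> : L2_dist (cut E g) (cut D g) =
    (\int[lebesgue_measure]_(s in E `\` D) (fnorm (g s) ^+ 2)%:E)%E.
  rewrite -(@integral_cut_sub _ _ _ _ `[0%R, +oo[); last by move=> s [/E0].
  apply: eq_integral => s _; rewrite /cut in_setD.
  have [sD|sD] := boolP (s \in D); last by rewrite andbT subr0.
  by rewrite (mem_set (DE _ (set_mem sD))) subrr.
have mG : measurable_fun E (fun s => (fnorm (g s) ^+ 2)%:E).
  apply/measurable_EFinP; apply: (measurable_funS _ E0) => //.
  exact: measurable_fnorm_sqr.
rewrite -[in RHS](setDUK DE) setUC ge0_integral_setU//.
- exact: measurableD.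
- by rewrite setUC setDUK.
- by move=> s _; rewrite lee_fin sqr_ge0.
- by apply/disj_setPS => s [[]].
Qed.

Lemma step_trunc_nd (phi : step R n d) u k : (k < step_size phi)%N ->
  Num.min (step_time phi k) u <= Num.min (step_time phi k.+1) u.
Proof. by move=> ks; rewrite le_min !ge_min lexx orbT (step_time_nd ks). Qed.

Lemma step_trunc_ge0 (phi : step R n d) u : 0 <= u -> forall k,
  (k <= step_size phi)%N -> 0 <= Num.min (step_time phi k) u.
Proof. by move=> u0 k ks; rewrite le_min u0 step_time_ge0. Qed.

Definition step_trunc (phi : step R n d) u (u0 : 0 <= u) : step R n d :=
  Step (step_coef phi) (@step_trunc_nd phi u) (@step_trunc_ge0 phi u u0).

Lemma step_val_trunc (phi : step R n d) u (u0 : 0 <= u) s : 0 <= s ->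
  step_val (step_trunc phi u0) s = cut `[0, u] (step_val phi) s.
Proof.
move=> s0; rewrite /cut mem_setE in_itv/= s0/=.
have [su|us] := leP s u.
  rewrite /step_val /=; apply: eq_bigl => k.
  rewrite gt_min le_min su andbT; congr andb.
  by have [us|] := ltP u s; rewrite ?orbF//; rewrite ltNge su in us.
rewrite /step_val big1// => k /=; rewrite le_min => /andP[_ /andP[_ su]].
by move: us; rewrite ltNge su.
Qed.

Lemma L2_dist_trunc (phi : step R n d) g u (u0 : 0 <= u) :
  mx_measurable g ->
  (L2_dist (step_val (step_trunc phi u0)) (cut `[0%R, u] g) <=
   L2_dist (step_val phi) (cut `[0%R, +oo[ g))%E.
Proof.
move=> mg.
have mh (h : R -> 'M[R]_(n, d)) : mx_measurable h ->
    mx_measurable (cut `[0%R, u] h).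
  move=> mh; apply: mx_measurable_cut => // i j.
  by apply: measurable_funS (mh i j) => // x /=; rewrite !in_itv/= => /andP[-> _].
have mh' (h : R -> 'M[R]_(n, d)) : mx_measurable h ->
    mx_measurable (cut `[0%R, +oo[ h).
  by move=> ?; apply: mx_measurable_cut.
apply: ge0_le_integral => //.
- by move=> s _; rewrite lee_fin sqr_ge0.
- apply/measurable_EFinP; apply: measurable_fnorm_sqr; apply: mx_measurableB.
    exact: mx_measurable_step.
  exact: mh.
- apply/measurable_EFinP; apply: measurable_fnorm_sqr; apply: mx_measurableB.
    exact: mx_measurable_step.
  exact: mh'.
- move=> s s0y; have s0 : 0 <= s by move: s0y; rewrite /= in_itv/= andbT.
  rewrite lee_fin step_val_trunc// /cut (mem_set s0y).
  by case: ifP => // _; rewrite subrr fnorm_sqr0 sqr_ge0.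
Qed.

End truncation.

(** * Borel-Cantelli and chaining *)

(** Borel-Cantelli along a net with polynomially many points per scale: a bound
    [exp (- 2 Q l)] on each of the at most [C Q^l] deviations of scale [l] makes
    their total probability at most of order [2^-l]. *)
Lemma ae_eventually_le (R : realType) (disp : measure_display)
    (T : measurableType disp) (P : probability T R) (Z : nat -> nat -> T -> R)
    (good : nat -> nat -> Prop) (eps : nat -> R) (C Q l0 : nat) :
  (0 < Q)%N -> (forall l i, measurable_fun setT (Z l i)) ->
  (forall l i, (l0 <= l)%N -> (i < C * Q ^ l)%N -> good l i ->
     (P [set w | (eps l < `|Z l i w|)%R] <=
       (2 * expR (- (2 * Q%:R * l%:R)))%:E)%E) ->
  {ae P, forall w, exists L, forall l i, (L <= l)%N -> (i < C * Q ^ l)%N ->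
     good l i -> `|Z l i w| <= eps l}.
Proof.
move=> Q0 mZ tail.
pose b l i : set T := if `[< good l i /\ (l0 <= l)%N >]
  then [set w | eps l < `|Z l i w|] else set0.
have mb l i : measurable (b l i).
  by rewrite /b; case: ifP => _ //; exact: measurable_gt_norm.
pose E l : set T := \big[setU/set0]_(i < C * Q ^ l) b l i.
have mE l : measurable (E l) by apply: bigsetU_measurable => i _.
have PE l : (P (E l) <= (4 * C%:R / (2 ^ l.+1)%:R)%:E)%E.
  apply: (@le_trans _ _ (\sum_(i < C * Q ^ l)
      (2 * expR (- (2 * Q%:R * l%:R)))%:E)%E).
    apply: le_trans (@Boole_inequality _ _ _ P (b l) (C * Q ^ l) _) _ => //.
    apply: lee_sum => i _; rewrite /b; case: asboolP => [[gi l0l]|_].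
      exact: tail.
    by rewrite measure0 lee_fin mulr_ge0// expR_ge0.
  rewrite sumEFin lee_fin sumr_const card_ord -[_ *+ (C * Q ^ l)]mulr_natr natrM natrX.
  have Qe : (2 * Q%:R) ^+ l <= expR (2 * Q%:R * l%:R) :> R.
    rewrite expRM_natr; apply: lerXn2r; rewrite ?nnegrE ?mulr_ge0 ?expR_ge0//.
    by apply: le_trans (expR_ge1Dx _); rewrite lerDr.
  have Q2 : 0 < (2 * Q%:R) ^+ l :> R by rewrite exprn_gt0// mulr_gt0// ltr0n.
  have -> : expR (- (2 * Q%:R * l%:R)) = (expR (2 * Q%:R * l%:R) : R)^-1.
    by rewrite expRN.
  apply: (@le_trans _ _ (2 * ((2 * Q%:R) ^+ l)^-1 * (C%:R * Q%:R ^+ l))).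
    rewrite ler_wpM2r ?mulr_ge0 ?exprn_ge0// ler_pM2l//.
    by rewrite lef_pV2 ?posrE// expR_gt0.
  rewrite le_eqVlt; apply/orP; left; apply/eqP.
  rewrite exprMn natrX exprS; field.
  by rewrite !expf_neq0// pnatr_eq0 -lt0n.
have S_fin : (\sum_(0 <= l <oo) P (E l) < +oo)%E.
  apply: le_lt_trans (ltry (4 * C%:R : R)).
  apply: le_trans (epsilon_trick0 xpredT _); last by rewrite mulr_ge0.
  by apply: lee_nneseries => // l _; exact: PE.
have limsup0 := lim_sup_set_cvg0 mE S_fin.
exists (lim_sup_set E); split => //.
  by apply: bigcap_measurable => // k _; exact: bigcup_measurable.
move=> w /= Hw L _; apply: contrapT => nE; apply: Hw.
exists (maxn L l0) => l i; rewrite geq_max => /andP[Ll l0l] iC gi.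
rewrite leNgt; apply/negP => Zw; apply: nE; exists l => //.
rewrite /E -bigcup_mkord; exists i => //=.
by rewrite /b asboolT.
Qed.

Section chaining.
Context (R : realType).

Lemma exists_scale (K : R) : exists l0, forall l, (l0 <= l)%N ->
  K * l%:R <= 4 ^+ l.
Proof.
exists (Num.truncn K).+1 => l Kl.
have Kl' : K <= l%:R.
  by apply: le_trans (ltW (truncnS_gt K)) _; rewrite ler_nat.
apply: le_trans (ler_wpM2r (ler0n _ _) Kl') _.
have l2 : (l <= 2 ^ l)%N by rewrite ltnW// ltn_expl.
by rewrite -natrM -natrX ler_nat -[4%N]/(2 * 2)%N expnMn leq_mul.
Qed.

(** A deviation [2 ^- l] of a variable of variance [c * 16 ^- l] has a Gaussian
    exponent of order [4 ^ l], which dominates every multiple of [l]. *)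
Lemma exists_scale_var (c Q : R) : exists l0, forall l, (l0 <= l)%N ->
  48 * (c * (16 ^+ l)^-1) * (2 * Q * l%:R) <= (2^-1 ^+ l) ^+ 2.
Proof.
have [l0 h] := exists_scale (96 * c * Q); exists l0 => l ll0.
have p4 : 0 < 4 ^+ l :> R by rewrite exprn_gt0.
have -> : 16 ^+ l = 4 ^+ l * 4 ^+ l :> R by rewrite -exprMn; congr (_ ^+ _); ring.
have -> : (2^-1 ^+ l) ^+ 2 = (4 ^+ l)^-1 :> R.
  by rewrite -exprM mulnC exprM -exprVn; congr (_ ^+ _); field.
rewrite invfM; have := h l ll0 => hl.
rewrite (_ : _ * _ * _ = (4 ^+ l)^-1 * ((96 * c * Q * l%:R) / 4 ^+ l)); last by ring.
by rewrite ler_piMr ?invr_ge0 ?(ltW p4)// ler_pdivrMr// mul1r.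
Qed.

Lemma truncn_mul_divn (x : R) (A : nat) : 0 <= x -> (0 < A)%N ->
  (Num.truncn (x * A%:R) %/ A)%N = Num.truncn x.
Proof.
move=> x0 A0; apply/esym/truncn_def.
have A0' : 0 < A%:R :> R by rewrite ltr0n.
have /andP[m1 m2] := truncn_itv (mulr_ge0 x0 (ltW A0')).
set m := Num.truncn _ in m1 m2 *.
apply/andP; split.
  rewrite -(ler_pM2r A0') -natrM; apply: le_trans m1.
  by rewrite ler_nat leq_trunc_div.
rewrite -(ltr_pM2r A0') -natrM; apply: lt_le_trans m2 _.
by rewrite ler_nat ltn_ceil.
Qed.

Lemma geometric_chain (y : nat -> R) (l k : nat) :
  (forall j, (l <= j)%N -> `|y j.+1 - y j| <= 2^-1 ^+ j) -> (l <= k)%N ->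
  `|y k - y l| <= 2 * 2^-1 ^+ l.
Proof.
move=> yS lk; suff : `|y k - y l| <= 2 * 2^-1 ^+ l - 2 * 2^-1 ^+ k.
  move=> /le_trans; apply; rewrite lerBlDr lerDl mulr_ge0// exprn_ge0.
elim: k lk => [|k IH].
  by rewrite leqn0 => /eqP->; rewrite !subrr normr0.
rewrite leq_eqVlt => /predU1P[<-|]; first by rewrite !subrr normr0.
rewrite ltnS => lk; have yk := yS k lk; have {}IH := IH lk.
rewrite (_ : y k.+1 - y l = (y k.+1 - y k) + (y k - y l)); last by ring.
apply: le_trans (ler_normD _ _) _; rewrite exprS; lra.
Qed.

Definition grid_index (A l : nat) (t : R) : nat := Num.truncn (t * A%:R ^+ l).
Definition grid_point (A l i : nat) : R := i%:R / A%:R ^+ l.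

Lemma grid_index_div (A l : nat) (t : R) : 0 <= t -> (0 < A)%N ->
  (grid_index A l.+1 t %/ A)%N = grid_index A l t.
Proof.
move=> t0 A0; rewrite /grid_index exprSr mulrA truncn_mul_divn//.
by rewrite mulr_ge0// exprn_ge0.
Qed.

Lemma grid_point_itv (A l : nat) (t : R) : 0 <= t -> (0 < A)%N ->
  grid_point A l (grid_index A l t) <= t <
  grid_point A l (grid_index A l t) + (A%:R ^+ l)^-1.
Proof.
move=> t0 A0; have Al : 0 < A%:R ^+ l :> R by rewrite exprn_gt0// ltr0n.
have /andP[m1 m2] := truncn_itv (mulr_ge0 t0 (ltW Al)).
rewrite /grid_point ler_pdivrMr// m1/=.
by rewrite -[X in _ + X]mul1r -mulrDl natr1 ltr_pdivlMr.
Qed.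

(** From [x t], with [t] of scale [l], one goes to the value of [x] at the grid
    point below [t] by refining the grid, the continuity of [x] closing the
    chain; from there to the array [N] at scale [l], and down the scales of [N]
    to a fixed scale [m].  As the clock [v] is then within [16 ^- m] of its end,
    that last value is close to [xinf]. *)
Lemma chaining_cvg (x : R -> R) (xinf vinf : R) (v : R -> R)
    (N : nat -> nat -> R) (A : nat) :
  (1 < A)%N -> {within `[0, +oo[, continuous x} ->
  (forall t, 0 <= t -> 0 <= v t) ->
  (forall e, 0 < e -> exists S, forall t, 0 <= t -> S <= t -> vinf - v t <= e) ->
  (exists L, forall l i, (L <= l)%N -> (i < 2 ^ l.+1 * A ^ l.+1)%N ->
     `|x (grid_point A l.+1 i) - x (grid_point A l (i %/ A))| <= 2^-1 ^+ l) ->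
  (exists L, forall l u, (L <= l)%N -> 0 <= u ->
     `|N l.+1 (grid_index 16 l.+1 (v u)) - N l (grid_index 16 l (v u))|
        <= 2^-1 ^+ l) ->
  (exists L, forall l u, (L <= l)%N -> 0 <= u -> vinf - v u <= (16 ^+ l)^-1 ->
     `|N l (grid_index 16 l (v u)) - xinf| <= 2^-1 ^+ l) ->
  (forall k : nat, exists L, forall l i, (L <= l)%N ->
     2 ^+ l <= grid_point A l i < 2 ^+ l.+1 ->
     `|x (grid_point A l i) - N l (grid_index 16 l (v (grid_point A l i)))|
       <= k.+1%:R^-1) ->
  x t @[t --> +oo] --> xinf.
Proof.
move=> A1 cx v0 hv [L1 h1] [L2 h2] [L3 h3] h4.
have A0 : (0 < A)%N by exact: ltnW.
have half0 k : 0 <= 2^-1 ^+ k :> R by rewrite exprn_ge0// invr_ge0.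
apply/cvgrPdist_le => e e0.
have e40 : 0 < e / 4 by rewrite divr_gt0.
have [k hk] : exists k : nat, k.+1%:R^-1 <= e / 4.
  exists (Num.truncn (e / 4)^-1); rewrite invf_ple ?posrE ?ltr0n//.
  by apply/ltW; exact: truncnS_gt.
have half_small d : 0 < d -> exists L, forall l, (L <= l)%N -> 2^-1 ^+ l <= d :> R.
  move=> d0; have : (fun n => 2^-1 ^+ n : R) @ \oo --> 0.
    by apply: cvg_expr; rewrite ger0_norm ?invr_ge0// invf_lt1// ltr1n.
  move=> /cvgrPdist_le/(_ d d0)[L _ hL]; exists L => l Ll.
  have := hL l Ll; rewrite sub0r normrN ger0_norm//.
have [L4 h4k] := h4 k.
have e120 : 0 < e / 12 by rewrite divr_gt0.
have [M hM] := half_small _ e120.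
pose m := maxn M (maxn L2 L3).
have mM : (M <= m)%N by rewrite leq_maxl.
have mL2 : (L2 <= m)%N by rewrite /m maxnCA leq_maxl.
have mL3 : (L3 <= m)%N by rewrite /m maxnA leq_maxr.
have [S hS] : exists S, forall t, 0 <= t -> S <= t -> vinf - v t <= (16 ^+ m)^-1.
  by apply: hv; rewrite invr_gt0 exprn_gt0.
pose L := maxn (maxn L1 L4) (maxn m (Num.truncn S).+1).
have [[LL1 LL4] [Lm LS]] :
    ((L1 <= L) /\ (L4 <= L))%N /\ ((m <= L) /\ ((Num.truncn S).+1 <= L))%N.
  by have := leqnn L; rewrite {1}/L !geq_max => /andP[/andP[-> ->] /andP[-> ->]].
have LM : (M <= L)%N := leq_trans mM Lm.
exists (2 ^+ L); split; first exact: num_real.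
move=> t /= Lt.
have t0 : 0 <= t by apply: le_trans (ltW Lt); rewrite exprn_ge0.
pose l := trunc_log 2 (Num.truncn t).
have Ltn : (2 ^ L <= Num.truncn t)%N by rewrite truncn_ge_nat// natrX ltW.
have /andP[lt1 lt2] : (2 ^ l <= Num.truncn t < 2 ^ l.+1)%N.
  by apply: trunc_log_bounds => //; apply: leq_trans Ltn; rewrite expn_gt0.
have Ll : (L <= l)%N by apply: trunc_log_max.
have {}lt1 : 2 ^+ l <= t by rewrite truncn_ge_nat// natrX in lt1.
have {}lt2 : t < 2 ^+ l.+1 by rewrite truncn_lt_nat// natrX in lt2.
pose tau := grid_point A l (grid_index A l t).
have /andP[tau_le _] := grid_point_itv l t0 A0.
have Apos j : 0 < A%:R ^+ j :> R by rewrite exprn_gt0// ltr0n.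
have tau_ge : 2 ^+ l <= tau.
  rewrite /tau /grid_point ler_pdivlMr// -!natrX -natrM ler_nat /grid_index.
  rewrite truncn_ge_nat ?mulr_ge0 ?(ltW (Apos l))//.
  by rewrite natrM !natrX ler_pM2r.
have tau0 : 0 <= tau by apply: le_trans tau_ge; rewrite exprn_ge0.
pose y j := x (grid_point A j (grid_index A j t)).
have yS j : (l <= j)%N -> `|y j.+1 - y j| <= 2^-1 ^+ j.
  move=> lj; rewrite /y -(@grid_index_div A j t)//.
  apply: h1; first exact: leq_trans (leq_trans LL1 Ll) lj.
  rewrite /grid_index truncn_lt_nat; last by rewrite mulr_ge0// ltW.
  rewrite natrM !natrX ltr_pM2r//; apply: lt_le_trans lt2 _.
  by rewrite ler_eXn2l// ?ltr1n.
have xy : `|x t - y l| <= 2 * 2^-1 ^+ l.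
  apply/ler_addgt0Pr => eta eta0.
  have /subspace_continuousP/(_ t) := cx.
  rewrite /= in_itv/= t0/= => /(_ isT)/cvgrPdist_lt/(_ _ eta0).
  rewrite near_withinE => /nbhs_ballP[del /= del0 hdel].
  have [J hJ] := half_small _ (divr_gt0 del0 (ltr0n R 2)).
  pose j := maxn J l.
  have Jj : (J <= j)%N by rewrite leq_maxl.
  have lj : (l <= j)%N by rewrite leq_maxr.
  have /andP[g1 g2] := grid_point_itv j t0 A0.
  have Aj : (A%:R ^+ j)^-1 <= 2^-1 ^+ j :> R.
    rewrite exprVn lef_pV2 ?posrE ?exprn_gt0 ?ltr0n//.
    by apply: lerXn2r; rewrite ?nnegrE ?ler_nat.
  have xtj : `|x t - y j| < eta.
    apply: hdel.
      rewrite -ball_normE/= ger0_norm ?subr_ge0//.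
      have := le_trans Aj (hJ j Jj); lra.
    by rewrite in_itv/= andbT divr_ge0// exprn_ge0.
  rewrite (_ : x t - y l = (x t - y j) + (y j - y l)); last by ring.
  apply: le_trans (ler_normD _ _) _; rewrite addrC.
  by apply: lerD (ltW xtj); exact: geometric_chain.
have xN := h4k l (grid_index A l t) (leq_trans LL4 Ll).
have {xN} := xN (ltac:(by rewrite tau_ge (le_lt_trans tau_le lt2))).
rewrite -/tau => xN.
pose z j := N j (grid_index 16 j (v tau)).
have zS : `|z l - z m| <= 2 * 2^-1 ^+ m.
  apply: geometric_chain; last exact: leq_trans Lm Ll.
  by move=> j mj; apply: h2 => //; exact: leq_trans mL2 mj.
have zinf : `|z m - xinf| <= 2^-1 ^+ m.
  apply: h3 => //; apply: hS => //.
  have S1 : S <= L%:R.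
    by apply: le_trans (ltW (truncnS_gt S)) _; rewrite ler_nat.
  apply: (le_trans S1); apply: le_trans tau_ge; rewrite -natrX ler_nat.
  by apply: leq_trans Ll (ltnW (ltn_expl _ _)).
have hl := hM l (leq_trans LM Ll); have hm := hM m mM.
rewrite distrC (_ : x t - xinf = (x t - y l) + (x tau - z l) + (z l - z m) +
  (z m - xinf)); last by rewrite /y -/tau; ring.
apply: le_trans (ler_normD _ _) _.
apply: le_trans (lerD (ler_normD _ _) (lexx _)) _.
apply: le_trans (lerD (lerD (ler_normD _ _) (lexx _)) (lexx _)) _.
have xN' : `|x tau - z l| <= e / 4 := le_trans xN hk.
lra.
Qed.

End chaining.

(** * The clock of the limiting martingale and almost sure bounds *)

Section convergence.
Context (R : realType) (disp : measure_display) (T : measurableType disp).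
Variables (P : probability T R) (n d : nat) (B : 'I_d -> R -> T -> R).
Hypothesis hB : mutually_independent_BMs P B.
Variable g : R -> 'M[R]_(n, d).
Hypothesis mg : mx_measurable g.
Hypothesis g_fin :
  (\int[lebesgue_measure]_(s in `[0%R, +oo[) (fnorm (g s) ^+ 2)%:E < +oo)%E.

Let mass (D : set R) : \bar R :=
  (\int[lebesgue_measure]_(s in D) (fnorm (g s) ^+ 2)%:E)%E.

(** The total quadratic variation of the limiting martingale, which serves as its
    clock. *)
Definition clock (t : R) : R := fine (mass `[0, t]).
Definition clock_end : R := fine (mass `[0, +oo[).

Let mass_ge0 (D : set R) : (0 <= mass D)%E.
Proof. by apply: integral_ge0 => s _; rewrite lee_fin sqr_ge0. Qed.

Let mass_fin (D : set R) : measurable D -> D `<=` `[0, +oo[ -> mass D \is a fin_num.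
Proof.
move=> mD D0; rewrite ge0_fin_numE//; apply: le_lt_trans g_fin.
apply: ge0_subset_integral => //.
- by apply/measurable_EFinP; exact: measurable_fnorm_sqr.
- by move=> s _; rewrite lee_fin sqr_ge0.
Qed.

Let dist_mass (D E : set R) : measurable D -> measurable E -> D `<=` E -> E `<=` `[0, +oo[ ->
  L2_dist (cut E g) (cut D g) = (fine (mass E) - fine (mass D))%:E.
Proof.
move=> mD mE DE E0; have D0 := subset_trans DE E0.
have split_E : (L2_dist (cut E g) (cut D g) + mass D = mass E)%E.
  exact: L2_dist_cut.
by rewrite EFinB !fineK ?mass_fin// -split_E addeK// mass_fin.
Qed.

Let sub0y (t : R) : `[0, t] `<=` `[0, +oo[.
Proof. by move=> x /=; rewrite !in_itv/= => /andP[-> _]. Qed.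

Let mcut (D : set R) : measurable D -> D `<=` `[0, +oo[ -> mx_measurable (cut D g).
Proof.
move=> mD D0; apply: mx_measurable_cut => // i j.
by apply: measurable_funS (mg i j).
Qed.

Lemma clock_ge0 t : 0 <= clock t.
Proof. exact: fine_ge0. Qed.

Lemma clock_dist s t : s <= t ->
  L2_dist (cut `[0, t] g) (cut `[0, s] g) = (clock t - clock s)%:E.
Proof.
move=> st; apply: dist_mass => // x /=.
by rewrite !in_itv/= => /andP[-> /le_trans]; exact.
Qed.

Lemma clock_end_dist t :
  L2_dist (cut `[0, +oo[ g) (cut `[0, t] g) = (clock_end - clock t)%:E.
Proof. exact: dist_mass. Qed.

Lemma clock_nd s t : s <= t -> clock s <= clock t.
Proof.
move=> st; have := L2_dist_ge0 (cut `[0, t] g) (cut `[0, s] g).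
by rewrite clock_dist// lee_fin subr_ge0.
Qed.

Lemma clock_le_end t : clock t <= clock_end.
Proof.
have := L2_dist_ge0 (cut `[0, +oo[ g) (cut `[0, t] g).
by rewrite clock_end_dist lee_fin subr_ge0.
Qed.

Lemma clock_cvg e : 0 < e -> exists S, forall t, 0 <= t -> S <= t ->
  clock_end - clock t <= e.
Proof.
move=> e0; pose G s := fnorm (cut `[0, +oo[ g s) ^+ 2.
have mG : measurable_fun setT G.
  apply: measurable_fnorm_sqr => i j.
  have /(measurable_restrictT _ _).1 := mg i j => /(_ (measurable_itv _)).
  congr measurable_fun; apply/funext => s; rewrite /cut patchE.
  by case: ifP => //; rewrite mxE.
have GE (D : set R) : D `<=` `[0, +oo[ ->
    (\int[lebesgue_measure]_(s in D) (G s)%:E = mass D)%E.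
  move=> D0; apply: eq_integral => s /set_mem/D0 sD.
  by rewrite /G /cut mem_set.
have := ge0_cvgn_integral (fun s => sqr_ge0 _) mG.
move=> /(_ lebesgue_measure); rewrite GE//.
under eq_fun do rewrite GE//.
have -> : mass `[0%R, +oo[ = clock_end%:E by rewrite /clock_end fineK// mass_fin.
under eq_fun do rewrite -[mass _]fineK ?mass_fin//.
move=> /fine_cvgP[_]/cvgrPdist_le/(_ _ e0)[k _ hk].
exists k%:R => t t0 kt; have := hk k (leqnn k); rewrite /= => /ler_normlW.
by apply: le_trans; rewrite lerB// clock_nd.
Qed.

(** A time is chosen in each cell of the clock that is visited; the other cells
    are given an arbitrary time. *)
Lemma clock_rep : exists rep : nat -> nat -> R,
  forall l i, 0 <= rep l i /\
    forall u, 0 <= u -> grid_index 16 l (clock u) = i ->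
      grid_index 16 l (clock (rep l i)) = i.
Proof.
have H (li : nat * nat) : exists s, 0 <= s /\
    forall u, 0 <= u -> grid_index 16 li.1 (clock u) = li.2 ->
      grid_index 16 li.1 (clock s) = li.2.
  have [[u [u0 ui]]|h] := pselect (exists u, 0 <= u /\
      grid_index 16 li.1 (clock u) = li.2); first by exists u.
  by exists 0; split=> // u u0 ui; exfalso; apply: h; exists u.
have [rep hrep] := choice H.
by exists (fun l i => rep (l, i)) => l i; exact: (hrep (l, i)).
Qed.

Lemma clock_close l u w : 0 <= u -> 0 <= w ->
  grid_index 16 l (clock u) = grid_index 16 l (clock w) ->
  (L2_dist (cut `[0%R, u] g) (cut `[0%R, w] g) <= ((16 ^+ l)^-1)%:E)%E.
Proof.
wlog wu : u w / w <= u.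
  move=> H u0 w0 uw; have [wu|/ltW uw'] := leP w u; first exact: H.
  by rewrite L2_distC; apply: H.
move=> u0 w0 E; rewrite clock_dist// lee_fin.
have /andP[_ h1] := @grid_point_itv R 16 l _ (clock_ge0 u) isT.
have /andP[h2 _] := @grid_point_itv R 16 l _ (clock_ge0 w) isT.
rewrite E in h1; lra.
Qed.

Variable Xinf : T -> 'cV[R]_n.
Hypothesis wXinf : wiener P B (cut `[0, +oo[ g) Xinf.

(** In each cell, the limiting martingale is replaced by the integral of a step
    function truncated at the chosen time; the error is comparable with the
    variation of the martingale inside the cell. *)
Lemma clock_array : exists (N : nat -> nat -> T -> 'cV[R]_n)
    (gN : nat -> nat -> R -> 'M[R]_(n, d)),
  [/\ forall l i, wiener P B (gN l i) (N l i),
      forall l i, mx_measurable (gN l i)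
    & forall l u, 0 <= u ->
      (L2_dist (gN l (grid_index 16 l (clock u))) (cut `[0%R, u] g) <=
        (4 * (16 ^+ l)^-1)%:E)%E].
Proof.
have [rep hrep] := clock_rep.
have /choice[phi hphi] l : exists phi : step R n d,
    (L2_dist (step_val phi) (cut `[0%R, +oo[ g) <= ((16 ^+ l)^-1)%:E)%E.
  have e0 : 0 < (16 ^+ l)^-1 :> R by rewrite invr_gt0 exprn_gt0.
  by have [_ /(_ _ e0)[phi [h _]]] := wXinf; exists phi.
pose psi l i := step_trunc (phi l) (hrep l i).1.
exists (fun l i => step_int B (psi l i)), (fun l i => step_val (psi l i)).
split=> [l i|l i|l u u0]; [exact: wiener_step|exact: mx_measurable_step|].
set i := grid_index _ _ _.
have [r0 /(_ u u0 erefl) hr] := hrep l i.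
have h1 : (L2_dist (step_val (psi l i)) (cut `[0%R, rep l i] g) <=
    ((16 ^+ l)^-1)%:E)%E.
  by apply: le_trans (hphi l); exact: L2_dist_trunc.
have h2 := clock_close r0 u0 hr.
have := L2_dist_triangle (mx_measurable_step (psi l i)) (mcut (measurable_itv _) (@sub0y _))
  (mcut (measurable_itv _) (@sub0y _)) h1 h2.
by move=> /le_trans; apply; rewrite lee_fin; lra.
Qed.

Lemma wiener_measurable h (Z : T -> 'cV[R]_n) : wiener P B h Z ->
  forall r, measurable_fun setT (fun w => Z w r 0).
Proof. by case. Qed.

Variables (X : R -> T -> 'cV[R]_n) (gX : R -> R -> 'M[R]_(n, d)).
Hypothesis wX : forall t, 0 <= t -> wiener P B (gX t) (X t).
Hypothesis mX : forall t, mx_measurable (gX t).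

(** The base of the grid absorbs the polynomial growth: for times up to
    [2 ^ l.+1] the increments of scale [l] have a variance of order
    [2 ^ (l * p) * A ^- l], that is, [16 ^- l]. *)
Lemma ae_grid_increments (c : R) (p : nat) r :
  0 < c ->
  (forall s t, 0 <= s -> s <= t -> t <= s + 1 ->
     (L2_dist (gX t) (gX s) <= (c * (1 + t) ^+ p * (t - s))%:E)%E) ->
  let A := (16 * 2 ^ p)%N in
  {ae P, forall w, exists L, forall l i, (L <= l)%N ->
    (i < 2 ^ l.+1 * A ^ l.+1)%N ->
    `|X (grid_point R A l.+1 i) w r 0 - X (grid_point R A l (i %/ A)) w r 0|
      <= 2^-1 ^+ l}.
Proof.
move=> c0 hc A.
have A0 : (0 < A)%N by rewrite muln_gt0 expn_gt0.
have Apos l : 0 < A%:R ^+ l :> R by rewrite exprn_gt0// ltr0n.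
have pt0 l i : 0 <= grid_point R A l i by rewrite divr_ge0// exprn_ge0.
have [l0 hl0] := exists_scale_var (c * 4 ^+ p) (2 * A)%:R.
have tail l i : (l0 <= l)%N -> (i < (2 * A) * (2 * A) ^ l)%N -> True ->
    (P [set w | (2^-1 ^+ l < `|X (grid_point R A l.+1 i) w r 0 -
        X (grid_point R A l (i %/ A)) w r 0|)%R] <=
      (2 * expR (- (2 * (2 * A)%:R * l%:R)))%:E)%E.
  move=> ll0 iA _.
  have v0 : 0 < c * 4 ^+ p * (16 ^+ l)^-1 by rewrite !mulr_gt0// ?invr_gt0 exprn_gt0.
  have e0 : 0 < 2^-1 ^+ l :> R by rewrite exprn_gt0// invr_gt0.
  apply: (@wiener_tail_le _ _ _ _ _ _ _ hB _ _ _ _ r _ _ _ (mX _) (mX _) (wX (pt0 _ _))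
    (wX (pt0 _ _)) e0 v0 _ (hl0 l ll0)).
  set t := grid_point R A l.+1 i; set s := grid_point R A l (i %/ A).
  have sE : s = ((i %/ A) * A)%:R / A%:R ^+ l.+1.
    rewrite /s /grid_point natrM exprS; field.
    by rewrite expf_neq0// pnatr_eq0 -lt0n.
  have st : s <= t.
    by rewrite sE /t /grid_point ler_pM2r ?invr_gt0// ler_nat leq_trunc_div.
  have ts : t - s <= (A%:R ^+ l)^-1.
    rewrite sE /t /grid_point -mulrBl ler_pdivrMr//.
    rewrite exprS mulrC mulfK ?gt_eqF// lerBlDl -natrD ler_nat.
    by rewrite -mulSnr ltnW// ltn_ceil.
  have ts1 : t <= s + 1.
    rewrite -lerBlDl; apply: le_trans ts _.
    by rewrite invf_le1// exprn_ege1// ler1n.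
  apply: le_trans (hc s t (pt0 _ _) st ts1) _.
  rewrite lee_fin -!mulrA ler_pM2l//.
  have t2 : t <= 2 ^+ l.+1.
    rewrite /t /grid_point ler_pdivrMr// -!natrX -natrM ler_nat ltnW//.
    by rewrite -expnMn expnS.
  have t0 : 0 <= t := pt0 _ _.
  have h1 : (1 + t) ^+ p <= 4 ^+ p * (2 ^+ l) ^+ p.
    rewrite -exprMn; apply: lerXn2r; rewrite ?nnegrE ?addr_ge0 ?mulr_ge0 ?exprn_ge0//.
    have : 1 <= 2 ^+ l :> R by rewrite exprn_ege1// ler1n.
    move: t2; rewrite exprS; lra.
  have -> : (16 ^+ l)^-1 = (2 ^+ l) ^+ p * (A%:R ^+ l)^-1 :> R.
    have nz : (2 ^+ l) ^+ p != 0 :> R by rewrite !expf_neq0// pnatr_eq0.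
    have sw : (2 ^+ p) ^+ l = (2 ^+ l) ^+ p :> R by rewrite -!exprM mulnC.
    by rewrite /A natrM natrX exprMn invfM mulrCA sw mulfV ?mulr1.
  rewrite mulrA; apply: ler_pM => //; first by rewrite exprn_ge0// addr_ge0.
  by rewrite subr_ge0.
have mZ l i : measurable_fun setT (fun w => X (grid_point R A l.+1 i) w r 0 -
    X (grid_point R A l (i %/ A)) w r 0).
  exact: measurable_funB (wiener_measurable (wX (pt0 _ _)) r)
    (wiener_measurable (wX (pt0 _ _)) r).
have := ae_eventually_le (Q := (2 * A)%N) _ mZ tail.
rewrite muln_gt0/= A0 => /(_ isT); apply: filterS => w [L hL].
by exists L => l i Ll iA; apply: hL; rewrite // -expnS expnMn.
Qed.

Lemma clock_lt_end u l : 0 <= u ->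
  (grid_index 16 l (clock u) < (Num.truncn clock_end).+1 * 16 ^ l)%N.
Proof.
move=> u0; rewrite /grid_index truncn_lt_nat ?mulr_ge0 ?clock_ge0 ?exprn_ge0//.
rewrite natrM natrX ltr_pM2r ?exprn_gt0//.
exact: le_lt_trans (clock_le_end u) (truncnS_gt _).
Qed.

Variables (N : nat -> nat -> T -> 'cV[R]_n) (gN : nat -> nat -> R -> 'M[R]_(n, d)).
Hypothesis wN : forall l i, wiener P B (gN l i) (N l i).
Hypothesis mN : forall l i, mx_measurable (gN l i).
Hypothesis gN_dist : forall l u, 0 <= u ->
  (L2_dist (gN l (grid_index 16 l (clock u))) (cut `[0%R, u] g) <=
    (4 * (16 ^+ l)^-1)%:E)%E.

Let inv16S l : (16 ^+ l.+1)^-1 = 16^-1 * (16 ^+ l)^-1 :> R.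
Proof. by rewrite exprS invfM. Qed.

Let inv16_gt0 l : 0 < (16 ^+ l)^-1 :> R.
Proof. by rewrite invr_gt0 exprn_gt0. Qed.

(** However long the range of times, the number of cells of scale [l] is at most
    a multiple of [16 ^ l], because the clock is bounded. *)
Lemma ae_clock_increments r : {ae P, forall w, exists L, forall l u, (L <= l)%N ->
  0 <= u -> `|N l.+1 (grid_index 16 l.+1 (clock u)) w r 0 -
              N l (grid_index 16 l (clock u)) w r 0| <= 2^-1 ^+ l}.
Proof.
have [rep hrep] := clock_rep.
have [l0 hl0] := @exists_scale_var R 16 16%:R.
pose Z l i w := N l.+1 (grid_index 16 l.+1 (clock (rep l.+1 i))) w r 0 -
              N l (grid_index 16 l (clock (rep l.+1 i))) w r 0.
have mZ l i : measurable_fun setT (Z l i).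
  exact: measurable_funB (wiener_measurable (wN _ _) r)
    (wiener_measurable (wN _ _) r).
have tail l i : (l0 <= l)%N -> (i < ((Num.truncn clock_end).+1 * 16) * 16 ^ l)%N ->
    True -> (P [set w | (2^-1 ^+ l < `|Z l i w|)%R] <=
      (2 * expR (- (2 * 16%:R * l%:R)))%:E)%E.
  move=> ll0 _ _; have [u0 _] := hrep l.+1 i; set u := rep l.+1 i in u0 *.
  have v0 : 0 < 16 * (16 ^+ l)^-1 :> R by rewrite mulr_gt0.
  have e0 : 0 < 2^-1 ^+ l :> R by rewrite exprn_gt0// invr_gt0.
  apply: (@wiener_tail_le _ _ _ _ _ _ _ hB _ _ _ _ r _ _ _ (mN _ _) (mN _ _) (wN _ _) (wN _ _)
    e0 v0 _ (hl0 l ll0)).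
  have d2 : (L2_dist (cut `[0%R, u] g) (gN l (grid_index 16 l (clock u))) <=
    (4 * (16 ^+ l)^-1)%:E)%E by rewrite L2_distC; exact: gN_dist.
  apply: le_trans (L2_dist_triangle (mN _ _) (mcut (measurable_itv _) (@sub0y _))
    (mN _ _) (gN_dist l.+1 u0) d2) _.
  by rewrite lee_fin inv16S; have := inv16_gt0 l; lra.
have := ae_eventually_le (Q := 16) isT mZ tail.
apply: filterS => w [L hL]; exists L => l u Ll u0.
pose i := grid_index 16 l.+1 (clock u).
have [u'0 /(_ u u0 erefl) E] := hrep l.+1 i.
have E' : grid_index 16 l (clock (rep l.+1 i)) = grid_index 16 l (clock u).
  by rewrite -(@grid_index_div R 16 l) ?clock_ge0// E grid_index_div ?clock_ge0.
have := hL l i Ll; rewrite /Z E E'; apply => //.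
by rewrite -mulnA -expnS; exact: clock_lt_end.
Qed.

Lemma ae_clock_end r : {ae P, forall w, exists L, forall l u, (L <= l)%N -> 0 <= u ->
  clock_end - clock u <= (16 ^+ l)^-1 ->
  `|N l (grid_index 16 l (clock u)) w r 0 - Xinf w r 0| <= 2^-1 ^+ l}.
Proof.
have [rep hrep] := clock_rep.
have [l0 hl0] := @exists_scale_var R 16 16%:R.
pose Z l i w := N l (grid_index 16 l (clock (rep l i))) w r 0 - Xinf w r 0.
have mZ l i : measurable_fun setT (Z l i).
  exact: measurable_funB (wiener_measurable (wN _ _) r)
    (wiener_measurable wXinf r).
(* The chosen time may be slightly earlier than [u], hence the factor 2. *)
pose good l i := clock_end - clock (rep l i) <= 2 * (16 ^+ l)^-1.
have tail l i : (l0 <= l)%N -> (i < (Num.truncn clock_end).+1 * 16 ^ l)%N ->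
    good l i -> (P [set w | (2^-1 ^+ l < `|Z l i w|)%R] <=
      (2 * expR (- (2 * 16%:R * l%:R)))%:E)%E.
  rewrite /good => ll0 _; have [u0 _] := hrep l i; set u := rep l i in u0 *.
  move=> hu.
  have v0 : 0 < 16 * (16 ^+ l)^-1 :> R by rewrite mulr_gt0.
  have e0 : 0 < 2^-1 ^+ l :> R by rewrite exprn_gt0// invr_gt0.
  have my : mx_measurable (cut `[0, +oo[ g) by exact: mcut.
  apply: (@wiener_tail_le _ _ _ _ _ _ _ hB _ _ _ _ r _ _ _ (mN _ _) my (wN _ _) wXinf
    e0 v0 _ (hl0 l ll0)).
  have d2 : (L2_dist (cut `[0%R, u] g) (cut `[0%R, +oo[ g) <=
    (2 * (16 ^+ l)^-1)%:E)%E by rewrite L2_distC clock_end_dist lee_fin.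
  apply: le_trans (L2_dist_triangle (mN _ _) (mcut (measurable_itv _) (@sub0y _))
    my (gN_dist l u0) d2) _.
  by rewrite lee_fin; have := inv16_gt0 l; lra.
have := ae_eventually_le (Q := 16) isT mZ tail.
apply: filterS => w [L hL]; exists L => l u Ll u0 hu.
pose i := grid_index 16 l (clock u).
have [u'0 /(_ u u0 erefl) E] := hrep l i.
have := hL l i Ll (clock_lt_end l u0); rewrite /Z E; apply.
rewrite /good.
have /andP[_ h1] := @grid_point_itv R 16 l _ (clock_ge0 u) isT.
have /andP[h2 _] := @grid_point_itv R 16 l _ (clock_ge0 (rep l i)) isT.
rewrite E -/i in h2; rewrite -/i in h1; lra.
Qed.

(** The variance is only [o(1 / l)], that is, [o(1 / log t)].  For a fixed
    [eps] this still gives exponents larger than any multiple of [l], enough for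
    the [2 * (2 * A) ^ l] grid points of scale [l]. *)
Lemma ae_grid_values (A : nat) (eps : R) r : (0 < A)%N -> 0 < eps ->
  (forall e, 0 < e -> exists l0, forall l t, (l0 <= l)%N -> 2 ^+ l <= t ->
     (L2_dist (gX t) (cut `[0%R, t] g) <= (e / l%:R)%:E)%E) ->
  {ae P, forall w, exists L, forall l i, (L <= l)%N ->
     2 ^+ l <= grid_point R A l i < 2 ^+ l.+1 ->
     `|X (grid_point R A l i) w r 0 -
       N l (grid_index 16 l (clock (grid_point R A l i))) w r 0| <= eps}.
Proof.
move=> A0 eps0 hg; pose Q := (2 * A)%N.
have Q0 : 0 < Q%:R :> R by rewrite ltr0n muln_gt0.
have Apos l : 0 < A%:R ^+ l :> R by rewrite exprn_gt0// ltr0n.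
have pt0 l i : 0 <= grid_point R A l i by rewrite divr_ge0// exprn_ge0.
(* Each of the two terms of the variance [2 * (e / l) + 8 * 16 ^- l] of the
   deviations may use up half of [eps ^+ 2] in [wiener_tail_le], for the exponent
   [2 * Q * l]; this value of [e] makes the first term do so exactly. *)
pose e := eps ^+ 2 / (384 * Q%:R).
have eps2 : 0 < eps ^+ 2 by rewrite exprn_gt0.
have e0 : 0 < e by apply: divr_gt0 eps2 _; apply: mulr_gt0 Q0; rewrite ltr0n.
have [l1 hl1] := hg e e0.
have [l2 hl2] := exists_scale (1536 * Q%:R / eps ^+ 2).
pose Z l i w := X (grid_point R A l i) w r 0 -
       N l (grid_index 16 l (clock (grid_point R A l i))) w r 0.
have mZ l i : measurable_fun setT (Z l i).
  exact: measurable_funB (wiener_measurable (wX (pt0 _ _)) r)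
    (wiener_measurable (wN _ _) r).
pose good l i := 2 ^+ l <= grid_point R A l i.
have tail l i : (maxn 1 (maxn l1 l2) <= l)%N -> (i < 2 * Q ^ l)%N ->
    good l i -> (P [set w | (eps < `|Z l i w|)%R] <=
      (2 * expR (- (2 * Q%:R * l%:R)))%:E)%E.
  rewrite !geq_max /good => /and3P[l1' ll1 ll2] _ hi.
  have lpos : 0 < l%:R :> R by rewrite ltr0n.
  have v0 : 0 < 2 * (e / l%:R) + 8 * (16 ^+ l)^-1 :> R.
    by rewrite addr_gt0// mulr_gt0// divr_gt0.
  apply: (@wiener_tail_le _ _ _ _ _ _ _ hB _ _ _ _ r _ _ _ (mX _) (mN _ _) (wX (pt0 _ _)) (wN _ _)
    eps0 v0).
    have d2 := gN_dist l (pt0 l i); rewrite L2_distC in d2.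
    apply: le_trans (L2_dist_triangle (mX _) (mcut (measurable_itv _) (@sub0y _))
      (mN _ _) (hl1 l _ ll1 hi) d2) _.
    by rewrite lee_fin; have := inv16_gt0 l; lra.
  have h2 := hl2 l ll2.
  have p4 : 1 <= 4 ^+ l :> R by rewrite exprn_ege1// ler1n.
  have -> : 16 ^+ l = 4 ^+ l * 4 ^+ l :> R by rewrite -exprMn; congr (_ ^+ _); ring.
  have h3 : 768 * Q%:R * l%:R / (4 ^+ l * 4 ^+ l) <= eps ^+ 2 / 2.
    rewrite ler_pdivrMr; last by rewrite mulr_gt0// (lt_le_trans _ p4).
    have -> : 768 * Q%:R * l%:R = eps ^+ 2 / 2 * (1536 * Q%:R / eps ^+ 2 * l%:R).
      by field; rewrite gt_eqF.
    rewrite ler_pM2l ?divr_gt0//; apply: le_trans h2 _.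
    by rewrite ler_peMr// (le_trans ler01 p4).
  have -> : 48 * (2 * (e / l%:R) + 8 / (4 ^+ l * 4 ^+ l)) * (2 * Q%:R * l%:R) =
      eps ^+ 2 / 2 + 768 * Q%:R * l%:R / (4 ^+ l * 4 ^+ l).
    rewrite /e; field.
    by rewrite !gt_eqF// (lt_le_trans ltr01 p4).
  lra.
have := ae_eventually_le (Q := Q) _ mZ tail.
rewrite muln_gt0/= A0 => /(_ isT); apply: filterS => w [L hL].
exists L => l i Ll /andP[hi1 hi2]; apply: hL => //.
rewrite -(ltr_nat R) natrM natrX natrM exprMn mulrA -exprS.
by move: hi2; rewrite /grid_point ltr_pdivrMr.
Qed.

End convergence.

(** * Almost sure convergence *)

Lemma ae_cvg_wiener (R : realType) (disp : measure_display)
    (T : measurableType disp) (P : probability T R) (n d : nat)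
    (B : 'I_d -> R -> T -> R) (hB : mutually_independent_BMs P B)
    (g : R -> 'M[R]_(n, d)) (gX : R -> R -> 'M[R]_(n, d))
    (X : R -> T -> 'cV[R]_n) (Xinf : T -> 'cV[R]_n) (c : R) (p : nat) r :
  mx_measurable g ->
  (\int[lebesgue_measure]_(s in `[0%R, +oo[) (fnorm (g s) ^+ 2)%:E < +oo)%E ->
  wiener P B (cut `[0, +oo[ g) Xinf ->
  (forall t, 0 <= t -> wiener P B (gX t) (X t)) ->
  (forall t, mx_measurable (gX t)) -> 0 < c ->
  (forall s t, 0 <= s -> s <= t -> t <= s + 1 ->
     (L2_dist (gX t) (gX s) <= (c * (1 + t) ^+ p * (t - s))%:E)%E) ->
  (forall e, 0 < e -> exists l0, forall l t, (l0 <= l)%N -> 2 ^+ l <= t ->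
     (L2_dist (gX t) (cut `[0%R, t] g) <= (e / l%:R)%:E)%E) ->
  {ae P, forall w, {within `[0, +oo[, continuous (fun t => X t w r 0)}} ->
  {ae P, forall w, X t w r 0 @[t --> +oo] --> Xinf w r 0}.
Proof.
move=> mg g_fin wXinf wX mX c0 incr lim cX.
have [N [gN [wN mN gN_dist]]] := clock_array hB mg g_fin wXinf.
pose A := (16 * 2 ^ p)%N.
have A1 : (1 < A)%N by rewrite /A (leq_trans _ (leq_pmulr _ _))// expn_gt0.
have E1 := ae_grid_increments hB wX mX r c0 incr.
have E2 := ae_clock_increments hB mg g_fin wN mN gN_dist r.
have E3 := ae_clock_end hB mg g_fin wXinf wN mN gN_dist r.
have E4 : {ae P, forall w, forall k : nat, exists L, forall l i, (L <= l)%N ->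
     2 ^+ l <= grid_point R A l i < 2 ^+ l.+1 ->
     `|X (grid_point R A l i) w r 0 -
       N l (grid_index 16 l (clock g (grid_point R A l i))) w r 0| <= k.+1%:R^-1}.
  apply: ae_foralln => k.
  apply: (ae_grid_values hB mg wX mX wN mN gN_dist) => //; first exact: ltnW.
apply: filterS (filterI cX (filterI E1 (filterI E2 (filterI E3 E4)))).
move=> w [cw [w1 [w2 [w3 w4]]]].
apply: (chaining_cvg A1 cw (v := clock g) (vinf := clock_end g)
  (N := fun l i => N l i w r 0)) => //.
- by move=> t _; exact: clock_ge0.
- exact: clock_cvg.
Qed.

Lemma cvg_mx_entries (R : realType) (n m : nat) (Fs : set_system R)
    (F : Filter Fs) (M : R -> 'M[R]_(n, m)) (l : 'M[R]_(n, m)) :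
  (forall i j, M t i j @[t --> Fs] --> l i j) -> M t @[t --> Fs] --> l.
Proof.
move=> Ml U [Q nQ QU].
have : \forall t \near Fs, forall i j, Q i j (M t i j).
  by apply: filter_forall => i; apply: filter_forall => j; exact: Ml.
by apply: filterS => t; exact: QU.
Qed.

Theorem theorem7 (R : realType) (disp : measure_display)
    (T : measurableType disp) (P : probability T R) (n d : nat)
    (hn : (1 <= n)%N) (hd : (1 <= d)%N)
    (B : 'I_d -> R -> T -> R) (hB : mutually_independent_BMs P B)
    (H H1 : R -> R -> 'M[R]_n) (hH : C10 H H1)
    (Hinf : R -> 'M[R]_n)
    (hHinf_cont : {within `[0, +oo[, continuous Hinf})
    (hHinf_L2 : (\int[lebesgue_measure]_(s in `[0%R, +oo[)
                   (fnorm (Hinf s) ^+ 2)%:E < +oo)%E)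
    (hlog : ((\int[lebesgue_measure]_(s in `[0%R, t])
                (fnorm (H t s - Hinf s) ^+ 2)%:E) * (ln t)%:E)%E
              @[t --> +oo] --> 0%E)
    (q cq : R) (hq : 0 <= q) (hcq : 0 < cq)
    (hH1 : forall t : R, 0 <= t ->
       (\int[lebesgue_measure]_(s in `[0%R, t]) (fnorm (H1 t s) ^+ 2)%:E
          <= (cq * (1 + t) `^ (2 * q))%:E)%E)
    (hdiag : forall t : R, 0 <= t ->
       fnorm (H t t) ^+ 2 <= cq * (1 + t) `^ (2 * q))
    (f : R -> 'M[R]_(n, d))
    (hf_cont : {within `[0, +oo[, continuous f})
    (hf_bd : exists M : R, forall t : R, 0 <= t -> fnorm (f t) <= M)
    (X : R -> T -> 'cV[R]_n)
    (hX : forall t : R, 0 <= t ->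
       is_ito_integral P B `[0, t] (fun s => H t s *m f s) (X t))
    (hX_cont : {ae P, forall w, {within `[0, +oo[, continuous (X ^~ w)}})
    (Xinf : T -> 'cV[R]_n)
    (hXinf : is_ito_integral P B `[0, +oo[ (fun s => Hinf s *m f s) Xinf) :
  {ae P, forall w, X t w @[t --> +oo] --> Xinf w}.
Proof.
have [M hM] := hf_bd; pose M2 := M ^+ 2.
have f_bd t : 0 <= t -> fnorm (f t) ^+ 2 <= M2.
  move=> t0; apply: lerXn2r (hM t t0); rewrite nnegrE ?fnorm_ge0//.
  exact: le_trans (fnorm_ge0 _) (hM t t0).
have M20 : 0 <= M2 by exact: sqr_ge0.
pose g s := Hinf s *m f s.
have mHinf i k : measurable_fun (`[0, +oo[%classic : set R) (fun s => Hinf s i k).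
  by apply: measurable_fun_half_line => //; exact: within_continuous_entry.
have mg : mx_measurable g by move=> i j; exact: measurable_mulmx.
have g_fin : (\int[lebesgue_measure]_(s in `[0%R, +oo[) (fnorm (g s) ^+ 2)%:E < +oo)%E.
  apply: (@le_lt_trans _ _ (\int[lebesgue_measure]_(s in `[0%R, +oo[)
      (M2%:E * (fnorm (Hinf s) ^+ 2)%:E))%E).
    apply: ge0_le_integral => //.
    - by move=> s _; rewrite lee_fin sqr_ge0.
    - by apply/measurable_EFinP; exact: measurable_fnorm_sqr.
    - by apply: measurable_funeM; apply/measurable_EFinP; exact: measurable_fnorm_sqr.
    - move=> s; rewrite /= in_itv/= andbT => s0; rewrite -EFinM lee_fin.
      exact: fnorm_sqr_mulf_le.
  rewrite ge0_integralZl_EFin//; last 2 first.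
  - by move=> s _; rewrite lee_fin sqr_ge0.
  - by apply/measurable_EFinP; exact: measurable_fnorm_sqr.
  by rewrite lte_mul_pinfty ?lee_fin.
have wXinf : wiener P B (cut `[0, +oo[ g) Xinf.
  apply: wiener_ito hXinf; first exact: interval_is_interval.
  by move=> s; rewrite /= in_itv/= andbT.
have wX t : 0 <= t -> wiener P B (integrand H f t) (X t).
  move=> t0; apply: wiener_ito (hX t t0); first exact: interval_is_interval.
  by move=> s; rewrite /= in_itv/= => /andP[].
have mX t : mx_measurable (integrand H f t).
  exact: (mx_measurable_integrand hH hf_cont).
pose p := (Num.truncn (2 * q)).+1.
have pow_le tau t : 0 <= tau -> tau <= t -> (1 + tau) `^ (2 * q) <= (1 + t) ^+ p.
  move=> tau0 taut.
  apply: (@le_trans _ _ ((1 + tau) ^+ p)).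
    rewrite -powR_mulrn ?addr_ge0//; apply: ler_powR; first by rewrite lerDl.
    exact: ltW (truncnS_gt _).
  by apply: lerXn2r; rewrite ?nnegrE ?addr_ge0// ?lerD2l// (le_trans tau0).
(* The term 1 makes [c] positive when [f] vanishes. *)
pose c := 4 * M2 * cq + 1.
have c0 : 0 < c by rewrite ltr_wpDl//; apply: mulr_ge0 (ltW hcq); exact: mulr_ge0.
have incr s t : 0 <= s -> s <= t -> t <= s + 1 ->
    (L2_dist (integrand H f t) (integrand H f s) <=
      (c * (1 + t) ^+ p * (t - s))%:E)%E.
  move=> s0 st ts1.
  have t0 := le_trans s0 st.
  pose K := cq * (1 + t) ^+ p.
  have hK tau : 0 <= tau -> tau <= t -> cq * (1 + tau) `^ (2 * q) <= K.
    by move=> tau0 taut; rewrite ler_pM2l// pow_le.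
  have K0 : 0 <= K by rewrite mulr_ge0 ?exprn_ge0 ?addr_ge0 ?(ltW hcq).
  apply: le_trans (@integrand_increment _ _ _ _ _ _ hH hf_cont _ f_bd s t K s0 st _ _) _.
  - move=> tau /andP[stau taut]; have tau0 := le_trans s0 stau.
    by apply: le_trans (hH1 tau tau0) _; rewrite lee_fin hK.
  - by move=> u /andP[u0 ut]; apply: le_trans (hdiag u u0) (hK u u0 ut).
  rewrite lee_fin.
  have h1 : (t - s) ^+ 2 <= t - s.
    by rewrite expr2 ler_piMr ?subr_ge0// lerBlDl.
  have ts0 : 0 <= t - s by rewrite subr_ge0.
  apply: (@le_trans _ _ (2 * M2 * K * (2 * (t - s)))).
    apply: ler_wpM2l; last by lra.
    exact: mulr_ge0 (mulr_ge0 (ler0n _ 2) M20) K0.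
  rewrite (_ : 2 * M2 * K * (2 * (t - s)) =
    4 * M2 * cq * ((1 + t) ^+ p * (t - s))); last by rewrite /K; ring.
  rewrite -[leRHS]mulrA; apply: ler_wpM2r; last by rewrite /c lerDl.
  by apply: mulr_ge0 ts0; rewrite exprn_ge0 ?addr_ge0.
have lim e : 0 < e -> exists l0, forall l t, (l0 <= l)%N -> 2 ^+ l <= t ->
    (L2_dist (integrand H f t) (cut `[0%R, t] g) <= (e / l%:R)%:E)%E.
  move=> e0.
  have ln20 : 0 < ln 2 :> R by rewrite ln_gt0// ltr1n.
  (* [ln 2] converts the scale [l] into the logarithm of [t]. *)
  pose del := e * ln 2 / (M2 + 1).
  have M21 : 0 < M2 + 1 by rewrite ltr_wpDl.
  have del0 : 0 < del by rewrite divr_gt0// mulr_gt0.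
  have [T0 [_ hT0]] : \forall t \near +oo,
      ((\int[lebesgue_measure]_(s in `[0%R, t])
          (fnorm (H t s - Hinf s) ^+ 2)%:E) * (ln t)%:E < del%:E)%E.
    apply: (hlog [set x | (x < del%:E)%E]).
    by apply: open_nbhs_nbhs; split; [exact: open_ereal_lt_ereal|rewrite /= lte_fin].
  exists (maxn 1 (Num.truncn T0).+1) => l t; rewrite geq_max => /andP[l1 lT] lt.
  have lpos : 0 < l%:R :> R by rewrite ltr0n.
  have p2 : 0 < 2 ^+ l :> R by rewrite exprn_gt0.
  have Tt : T0 < t.
    apply: lt_le_trans (truncnS_gt T0) _; apply: le_trans lt.
    by rewrite -natrX ler_nat (leq_trans lT)// ltnW// ltn_expl.
  have lnt : l%:R * ln 2 <= ln t.
    by rewrite mulr_natl -lnXn// ler_ln ?posrE// (lt_le_trans p2).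
  have l20 : 0 < l%:R * ln 2 :> R by rewrite mulr_gt0.
  have v_le : (\int[lebesgue_measure]_(s in `[0%R, t])
      (fnorm (H t s - Hinf s) ^+ 2)%:E <= (del / (l%:R * ln 2))%:E)%E.
    rewrite EFinM lee_pdivlMr//; apply: le_trans (ltW (hT0 t Tt)).
    by apply: lee_wpmul2l; [apply: integral_ge0 => s _; rewrite lee_fin sqr_ge0|].
  apply: le_trans (integrand_limit_dist hH hf_cont f_bd hHinf_cont v_le) _.
  rewrite lee_fin /del.
  rewrite (_ : M2 * _ = e / l%:R * (M2 / (M2 + 1))); last first.
    by field; rewrite !gt_eqF.
  rewrite ler_piMr ?divr_ge0 ?(ltW e0) ?(ltW lpos)//.
  by rewrite ler_pdivrMr// mul1r lerDl.
have entry r : {ae P, forall w, X t w r 0 @[t --> +oo] --> Xinf w r 0}.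
  have cX : {ae P, forall w, {within `[0, +oo[, continuous (fun t => X t w r 0)}}.
    by apply: filterS hX_cont => w; exact: within_continuous_entry.
  exact: (ae_cvg_wiener hB mg g_fin wXinf wX mX c0 incr lim cX).
have : {ae P, forall w r, X t w r 0 @[t --> +oo] --> Xinf w r 0}.
  exact: filter_forall.
apply: filterS => w hw; apply: cvg_mx_entries => i j.
by rewrite (ord1 j); exact: hw.
Qed.
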